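(* Let $a<b$ be real numbers, $\delta(x)=\min\{b-x,x-a\}$ for $x\in[a,b]$, and $\delta_0=\frac{b-a}{2}$. Let $m>0$, $\nu\in(0,1/m]$, and let $f$ be an absolutely continuous function on $[a,b]$ such that $f(a)=f(b)=0$ and $f'/\delta\in L^1[a,b]$. (i) If $\lambda\in\left[0,\frac{1+\nu m}{2}\right)$, then $$\frac{1-\nu^2m^2}{4}\int_a^b\frac{|f(x)|}{\delta(x)^2}\,dx+\frac{c_\nu^2(m)}{\delta_0^m}\int_a^b\frac{|f(x)|}{\delta(x)^{2-m}}\,dx\le\left(\frac{1+\nu m}{2}-\lambda^2\right)\int_a^b\frac{|f'(x)|}{\delta(x)}\,dx+\frac{\lambda^2-\lambda}{\delta_0}\int_a^b|f'(x)|\,dx.$$ (ii) If $\lambda\le 0$, then $$\frac{1-\nu^2m^2}{4}\int_a^b\frac{|f(x)|}{\delta(x)^2}\,dx+\frac{c_\nu^2(m)}{\delta_0^m}\int_a^b\frac{|f(x)|}{\delta(x)^{2-m}}\,dx\le\frac{1+\nu m}{2}\int_a^b\frac{|f'(x)|}{\delta(x)}\,dx-\frac{\lambda}{\delta_0}\int_a^b|f'(x)|\,dx.$$ Here $c_\nu(m)$ (which depends on $\lambda$) is the number satisfying $$(1-2\lambda)J_\nu\left(\tfrac{2}{m}c_\nu(m)\right)+2c_\nu(m)J_\nu'\left(\tfrac{2}{m}c_\nu(m)\right)=0\quad\text{and}\quad \tfrac{2}{m}c_\nu(m)\in(0,j_\nu).$$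
   Context: $J_\nu$ is the Bessel function of the first kind of order $\nu$, $J_\nu'$ its derivative, and $j_\nu$ the first positive zero of $J_\nu$; $c_\nu(m)$ is taken to be the first such root. *)

(* Defs.v *)
From HB Require Import structures.
From mathcomp Require Import all_boot all_order all_algebra.
From mathcomp Require Import all_classical all_reals all_analysis.
Set Implicit Arguments.
Unset Strict Implicit.
Unset Printing Implicit Defensive.
Import Order.TTheory GRing.Theory Num.Theory.
Import numFieldNormedType.Exports.
Local Open Scope classical_set_scope.
Local Open Scope ring_scope.

Definition abs_continuous {R : realType} (a b : R) (f : R -> R) : Prop :=
  forall e : R, 0 < e -> exists2 d : R, 0 < d &
    forall (n : nat) (x y : 'I_n -> R),
      (forall i, [/\ a <= x i, x i <= y i & y i <= b]) ->
      trivIset [set: 'I_n] (fun i => [set` `]x i, y i[ ]) ->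
      \sum_(i < n) (y i - x i) < d ->
      \sum_(i < n) `|f (y i) - f (x i)| < e.

(* Euler's integral; convergent, hence meaningful, for [0 < s] only. *)
Definition Gamma {R : realType} (s : R) : R :=
  \int[@lebesgue_measure R]_(t in [set` `]0, +oo[ ]) (t `^ (s - 1) * expR (- t)).

(* The power [`^] has a real exponent, so this is the Bessel function on the
   half-line [0 < x] only. *)
Definition besselJ {R : realType} (nu x : R) : R :=
  limn (series (fun k : nat =>
    (-1) ^+ k / (k`!%:R * Gamma (nu + k%:R + 1))
      * (x / 2) `^ (nu + 2 * k%:R))).

(* For [0 < nu] the positive zeros of J_nu are bounded away from 0, so the
   infimum is attained: it is the first positive zero. *)
Definition bessel_zero {R : realType} (nu : R) : R :=
  inf [set x : R | 0 < x /\ besselJ nu x = 0].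

Definition is_bessel_root {R : realType} (nu m lambda c : R) : Prop :=
  [/\ (1 - 2 * lambda) * besselJ nu (2 / m * c)
        + 2 * c * derive1 (besselJ nu) (2 / m * c) = 0,
      0 < 2 / m * c
    & 2 / m * c < bessel_zero nu].

Definition is_first_bessel_root {R : realType} (nu m lambda c : R) : Prop :=
  is_bessel_root nu m lambda c /\
  forall c' : R, is_bessel_root nu m lambda c' -> c <= c'.

Definition delta {R : realType} (a b x : R) : R := Num.min (b - x) (x - a).

Definition delta0 {R : realType} (a b : R) : R := (b - a) / 2.

(* Main.v *)
Require Import Defs.
From HB Require Import structures.
From mathcomp Require Import all_boot all_order all_algebra.
From mathcomp Require Import all_classical all_reals all_analysis.
From mathcomp Require Import measurable_realfun ring lra.

(** Write h for half the length of [a, b], B for (1 + nu m) / 2 and, for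
    0 < s <= h,
      w s = (1 - nu^2 m^2) / (4 s^2) + (c^2 / h^m) / s^(2 - m),
    so that the left-hand side is the integral of |f| w(delta).

    On the left half of the interval |f x| is at most the integral of |f'| over
    [a, x], because f a = 0; on the right half the same holds with [x, b].
    Exchanging the two integrations (Tonelli), the left-hand side is at most
    the integral of |f'(t)| times the integral of w over [delta t, h]
    ([kernel_test], [hardy_majorant]).  It remains to bound the latter,
    pointwise in s = delta t, by
      (B - lambda^2) / s + (lambda^2 - lambda) / h   in case (i),
      B / s - lambda / h                             in case (ii).

    The Bessel function enters here.  The function
    z s = sqrt s * J_nu ((2 c / m) (s / h)^(m / 2)) satisfies z'' + w z = 0 and,
    by the condition defining c, z' h / z h = lambda / h.  It has no zero on
    ]0, h], as 2 c / m lies before the first zero of J_nu.  Hence p = z' / z is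
    defined there and p' = - w - p^2, so that the integral of w over [s, h] is
    p s - lambda / h minus the integral of p^2.  Moreover s p s decreases, from
    B at 0 to lambda at h: the upper bound p s <= B / s gives (ii), and for
    0 <= lambda the lower bound lambda / s <= p s also controls p^2 from below
    and gives (i) ([weight_majorant_le0], [weight_majorant_ge0]).

    All this is carried out on the entire series phi in y = (x / 2)^2 for which
    J_nu x = (x / 2)^nu phi y / Gamma (nu + 1).  The decrease of s p s is that
    of y phi' / phi, whose derivative is - M / phi^2 with
    (y^(nu + 1) M)' = y^nu phi^2 ([logder_slope_ge0]).  The value of Gamma
    enters through its recursion ([GammaD1]).

    The estimate |f y - f x| <= integral of |f'| over [x, y] is the fundamental
    theorem for absolutely continuous functions ([le_integral_derive1]).  The
    total variation of f is again absolutely continuous, so f is a difference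
    of two nondecreasing absolutely continuous functions; the Stieltjes measure
    of such a function is dominated by Lebesgue measure, the Radon-Nikodym
    theorem provides a density, and Lebesgue differentiation identifies it with
    f' almost everywhere. *)

Set Implicit Arguments.
Unset Strict Implicit.
Unset Printing Implicit Defensive.
Import Order.TTheory GRing.Theory Num.Theory.
Import numFieldNormedType.Exports.
Local Open Scope classical_set_scope.
Local Open Scope ring_scope.

(** * The recursion of the Gamma integral *)
Lemma powR_expRN_cvg0 (R : realType) (s : R) :
  (n%:R `^ s * expR (- n%:R) : R) @[n --> \oo] --> (0 : R).
Proof.
have [k sk] : exists k : nat, s <= k%:R.
  by exists (Num.bound `|s|); rewrite (le_trans (ler_norm s))// ltW// archi_boundP.
(* One term of the exponential series beats the power. *)
have key n : n%:R `^ s * expR (- n%:R) <= k.+1`!%:R * (harmonic n.-1 : R).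
  case: n => [|n].
    rewrite /= oppr0 expR0 mulr1 /harmonic invr1 mulr1 /powR eqxx.
    by rewrite (le_trans (_ : _ <= 1))// ?lern1 ?leq_b1// ler1n fact_gt0.
  rewrite /= expRN ler_pdivrMr ?expR_gt0// (le_trans (ler_powR _ sk)) ?ler1n//.
  rewrite powR_mulrn// mulrAC ler_pdivlMr// -exprSr.
  rewrite -ler_pdivrMl ?ltr0n ?fact_gt0// mulrC.
  apply: le_trans (expR_ge1Dxn k _) => //.
  by rewrite lerDr.
apply: (@squeeze_cvgr _ _ _ _ (fun=> 0) (fun n => k.+1`!%:R * harmonic n.-1)).
- by near=> n; rewrite key mulr_ge0 ?powR_ge0 ?expR_ge0.
- exact: cvg_cst.
- rewrite -[X in _ --> X](mulr0 k.+1`!%:R); apply: cvgMr.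
  by rewrite -cvg_shiftS/=; exact: cvg_harmonic.
Unshelve. all: by end_near. Qed.

Lemma continuous_powR (R : realType) (s x : R) : 0 < x ->
  {for x, continuous (fun t : R => t `^ s)}.
Proof.
move=> x0; apply: differentiable_continuous; apply/derivable1_diffP.
by apply: ex_derive; exact: is_derive1_powR.
Qed.

Lemma powR_right_continuous0 (R : realType) (s : R) : 0 < s ->
  t `^ s @[t --> (0:R)^'+] --> (0 : R) `^ s.
Proof. by move=> s0; rewrite powR0 ?gt_eqF//; exact: powR_cvg0. Qed.

Lemma within_continuous_powR (R : realType) (s b : R) : 0 < s -> 0 < b ->
  {within `[0, b], continuous (fun t : R => t `^ s)}.
Proof.
move=> s0 b0; apply/continuous_within_itvP => //; split.
- by move=> x; rewrite in_itv/= => /andP[x0 _]; exact: continuous_powR.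
- exact: powR_right_continuous0.
- exact/cvg_at_left_filter/continuous_powR.
Qed.

(** Integration by parts on [0, n], then n tends to infinity.  The computation
    takes place in the extended reals and covers a divergent integral as well:
    its real value is then 0 by convention, and so is that of s times it. *)
Lemma GammaD1 (R : realType) (s : R) : 1 < s -> Gamma (s + 1) = s * Gamma s.
Proof.
move=> s1; have s0 : 0 < s by lra.
pose mu := @lebesgue_measure R.
pose G := fun t : R => t `^ s * expR (- t).
pose g := fun t : R => s * t `^ (s - 1) * expR (- t).
have cN : forall b : R, {within `[0, b], continuous (fun t : R => expR (- t))}.
  move=> b; apply: continuous_subspaceT => x.
  by apply: continuous_comp; [exact: opp_continuous|exact: continuous_expR].
have parts (n : nat) : (0 < n)%N -> (\int[mu]_(t in `[0%R, n%:R]) (G t)%:E =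
    (- (n%:R `^ s * expR (- n%:R)))%:E + \int[mu]_(t in `[0%R, n%:R]) (g t)%:E)%E.
  move=> n0; have n0R : (0 : R) < n%:R by rewrite ltr0n.
  pose F := fun t : R => t `^ s.
  pose E := fun t : R => - expR (- t).
  pose f := fun t : R => s * t `^ (s - 1).
  pose e := fun t : R => expR (- t).
  have := @integration_by_parts R F E f e 0 n%:R n0R.
  have dE (t : R) : is_derive t 1 E (e t).
    by rewrite /E /e; apply: is_derive_eq; rewrite mulrN1 opprK.
  have dF (t : R) : t \in `]0, (n%:R : R)[ -> is_derive t 1 F (f t).
    by rewrite in_itv/= => /andP[t0 _]; exact: is_derive1_powR.
  rewrite (_ : (fun x => (F x * e x)%:E) = (fun x => (G x)%:E))//.
  move=> ->.
  - have -> : F 0 * E 0 = 0 by rewrite /F powR0 ?mul0r// gt_eqF.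
    rewrite subr0 (_ : F n%:R * E n%:R = - (n%:R `^ s * expR (- n%:R))); last first.
      by rewrite /F /E mulrN.
    congr (_ + _)%E.
    rewrite (_ : (fun x => _) = fun x => (- (g x)%:E)%E); last first.
      by apply/funext => x; rewrite -EFinN /f /E /g mulrN.
    rewrite integral_ge0N ?oppeK// => x; rewrite /= in_itv/= => /andP[x0 _].
    by rewrite lee_fin !mulr_ge0 ?powR_ge0 ?expR_ge0// ltW.
  - move=> x; apply: cvgM; first exact: cvg_cst.
    by apply: within_continuous_powR => //; lra.
  - have := within_continuous_powR s0 n0R.
    move=> /continuous_within_itvP -/(_ n0R)[_ c1 c2]; split => //.
    by move=> t /dF [].
  - by move=> t tn; rewrite derive1E; have [_ ->] := dF t tn.
  - exact: cN.
  - split.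
    + by move=> t _; have [] := dE t.
    + by apply: cvg_at_right_filter; apply: differentiable_continuous;
        apply/derivable1_diffP; have [] := dE 0.
    + by apply: cvg_at_left_filter; apply: differentiable_continuous;
        apply/derivable1_diffP; have [] := dE n%:R.
  - by move=> t _; rewrite derive1E; have [_ ->] := dE t.
have mpow p : measurable_fun [set: R] (fun t : R => t `^ p * expR (- t)).
  apply: measurable_funM; first exact: measurable_powR.
  by apply: measurableT_comp => //; exact: measurable_expR.
have pow0 p t : (0 <= (t `^ p * expR (- t))%:E :> \bar R)%E.
  by rewrite lee_fin mulr_ge0 ?powR_ge0 ?expR_ge0.
have lim p : (\int[mu]_(t in `[0%R, n%:R]) (t `^ p * expR (- t))%:E
    @[n --> \oo] --> \int[mu]_(t in `]0%R, +oo[) (t `^ p * expR (- t))%:E)%E.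
  rewrite integral_itv_obnd_cbnd; last first.
    by apply/measurable_EFinP; exact: measurable_funTS.
  rewrite itv_bndy_bigcup_BRight.
  rewrite (eq_bigcupr (G := fun n : nat => `[0, (n%:R : R)]%classic)); last first.
    by move=> n _; rewrite add0r.
  apply: ge0_nondecreasing_set_cvg_integral => //.
  - move=> i j ij; apply/subsetPset => x /=; rewrite !in_itv/= => /andP[-> /=].
    by move=> /le_trans; apply; rewrite ler_nat.
  - by move=> i; apply: measurable_funTS; apply/measurable_EFinP; exact: mpow.
have gE : (\int[mu]_(t in `]0%R, +oo[) (G t)%:E =
    s%:E * \int[mu]_(t in `]0%R, +oo[) (t `^ (s - 1) * expR (- t))%:E)%E.
  have l1 := lim s.
  have l2 : ((- (n%:R `^ s * expR (- n%:R)))%:E +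
      s%:E * \int[mu]_(t in `[0%R, n%:R]) (t `^ (s - 1) * expR (- t))%:E
      @[n --> \oo] --> (0%R : R)%:E +
      s%:E * \int[mu]_(t in `]0%R, +oo[) (t `^ (s - 1) * expR (- t))%:E)%E.
    apply: cvgeD => //.
      by apply: cvg_EFin; [exact: nearW|rewrite -oppr0; apply: cvgN;
        exact: powR_expRN_cvg0].
    by apply: cvgeZl => //; exact: lim.
  rewrite add0e in l2; apply: cvg_unique l1 _ => //.
  apply: cvg_trans l2; apply: near_eq_cvg; near=> n.
  rewrite -/G parts; last by near: n; exact: nbhs_infty_gt.
  congr (_ + _)%E; rewrite -ge0_integralZl_EFin//; last 2 first.
    by apply: measurable_funTS; apply/measurable_EFinP; exact: mpow.
    exact: ltW.
  by apply: eq_integral => t _; rewrite -EFinM /g mulrA.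
rewrite /Gamma /Rintegral addrK -/G gE.
case: integral => [r| |] //=; first by rewrite gt0_muley ?lte_fin//= mulr0.
by rewrite gt0_muleNy ?lte_fin//= mulr0.
Unshelve. all: by end_near. Qed.

(** * Bessel functions as entire series *)
Section entire_series.
Variable R : realType.
Implicit Types (u : R^nat) (x : R).

(** This bound is stable under termwise differentiation, so that it yields the
    convergence of a power series and of all its derivatives at once. *)
Definition fact_bounded u := forall k, `|u k| <= k`!%:R^-1.

Lemma fact_bounded_diffs u : fact_bounded u -> fact_bounded (pseries_diffs u).
Proof.
move=> ub k; rewrite /pseries_diffs normrM ger0_norm//.
rewrite -ler_pdivlMl// -invfM -natrM -factS; exact: ub.
Qed.

Lemma fact_bounded_cvg u x : fact_bounded u -> cvgn (pseries u x).
Proof.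
move=> ub; apply: normed_cvg.
apply: (@series_le_cvg _ _ (exp_coeff `|x|)).
- by move=> n /=.
- by move=> n; apply: exp_coeff_ge0.
- move=> n; rewrite /= normrM normrX exp_coeffE mulrC.
  by rewrite [leRHS]mulrC ler_wpM2l// exprn_ge0.
- exact: is_cvg_series_exp_coeff.
Qed.

Lemma fact_bounded_derive u x : fact_bounded u ->
  is_derive x 1 (fun y => limn (pseries u y)) (limn (pseries (pseries_diffs u) x)).
Proof.
move=> ub; have ub1 := fact_bounded_diffs ub.
have ub2 := fact_bounded_diffs ub1.
apply: (@pseries_snd_diffs _ _ (`|x| + 1)); try exact: fact_bounded_cvg.
by rewrite [ltRHS]ger0_norm ?addr_ge0// ltrDl.
Qed.

End entire_series.

Section bessel_series.
Variables (R : realType) (nu : R).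
Hypothesis nu0 : 0 < nu.

Definition bessel_coeff : R^nat := fun k =>
  (-1) ^+ k / (k`!%:R * \prod_(i < k) (nu + i%:R + 1)).

(** With y = (x / 2)^2 this is Gamma (nu + 1) (x / 2)^(- nu) J_nu x: the factor
    of J_nu that is analytic at 0 and carries its positive zeros. *)
Definition reduced_bessel (y : R) := limn (pseries bessel_coeff y).
Definition reduced_bessel1 (y : R) := limn (pseries (pseries_diffs bessel_coeff) y).
Definition reduced_bessel2 (y : R) :=
  limn (pseries (pseries_diffs (pseries_diffs bessel_coeff)) y).

Let rising_ge1 k : 1 <= \prod_(i < k) (nu + i%:R + 1).
Proof.
elim/big_ind : _ => // [x y x1 y1|i _]; first by rewrite mulr_ege1.
by rewrite lerDr addr_ge0// ltW.
Qed.

Lemma bessel_coeff_bounded : fact_bounded bessel_coeff.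
Proof.
move=> k; rewrite /bessel_coeff normrM normrX normrN1 expr1n mul1r.
have f0 : 0 < k`!%:R :> R by rewrite ltr0n fact_gt0.
have p0 := lt_le_trans ltr01 (rising_ge1 k).
rewrite normfV ger0_norm; last by rewrite mulr_ge0// ltW.
by rewrite lef_pV2 ?posrE ?mulr_gt0// ler_peMr// ltW.
Qed.

Lemma bessel_coeff_rec k :
  (nu + k%:R + 1) * k.+1%:R * bessel_coeff k.+1 = - bessel_coeff k.
Proof.
rewrite /bessel_coeff exprS mulN1r factS natrM big_ord_recr/=.
have f0 : k`!%:R != 0 :> R by rewrite pnatr_eq0 -lt0n fact_gt0.
have p0 : \prod_(i < k) (nu + i%:R + 1) != 0.
  by rewrite gt_eqF// (lt_le_trans ltr01 (rising_ge1 k)).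
have k0 : k.+1%:R != 0 :> R by rewrite pnatr_eq0.
have n0 : nu + k%:R + 1 != 0 by rewrite gt_eqF// addr_gt0// ltr_wpDr.
rewrite !invfM mulNr mulrN; congr (- _).
by field; rewrite n0 p0 f0 addrC natr1 k0.
Qed.

Let cc0 := bessel_coeff_bounded.
Let cc1 := fact_bounded_diffs cc0.
Let cc2 := fact_bounded_diffs cc1.

Lemma is_derive_reduced_bessel (y : R) : is_derive y 1 reduced_bessel (reduced_bessel1 y).
Proof. exact: fact_bounded_derive. Qed.

Lemma is_derive_reduced_bessel1 (y : R) :
  is_derive y 1 reduced_bessel1 (reduced_bessel2 y).
Proof. exact: fact_bounded_derive. Qed.

Lemma reduced_bessel0 : reduced_bessel 0 = 1.
Proof.
apply/cvg_lim => //; rewrite -cvg_shiftS/=.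
apply: cvg_near_cst; near=> n; rewrite /pseries /series/= big_nat_recl//= big1.
  by rewrite /bessel_coeff fact0 big_ord0 !expr0 !mulr1 divr1 addr0.
by move=> i _; rewrite expr0n mulr0.
Unshelve. all: by end_near. Qed.

(** Bessel's equation in the variable y; on coefficients it is
    [bessel_coeff_rec]. *)
Lemma reduced_bessel_ode y :
  y * reduced_bessel2 y + (nu + 1) * reduced_bessel1 y + reduced_bessel y = 0.
Proof.
have c0 : pseries bessel_coeff y n.+1 @[n --> \oo] --> reduced_bessel y.
  by rewrite cvg_shiftS; exact: fact_bounded_cvg.
have c1 : pseries (pseries_diffs bessel_coeff) y n.+1 @[n --> \oo] --> reduced_bessel1 y.
  by rewrite cvg_shiftS; exact: fact_bounded_cvg.
have c2 : pseries (pseries_diffs (pseries_diffs bessel_coeff)) y n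
    @[n --> \oo] --> reduced_bessel2 y by exact: fact_bounded_cvg.
have lim : (y * pseries (pseries_diffs (pseries_diffs bessel_coeff)) y n +
    (nu + 1) * pseries (pseries_diffs bessel_coeff) y n.+1 +
    pseries bessel_coeff y n.+1) @[n --> \oo]
    --> y * reduced_bessel2 y + (nu + 1) * reduced_bessel1 y + reduced_bessel y.
  by apply: cvgD c0; apply: cvgD; apply: cvgMr.
(* The first sum is one term shorter: y multiplies a second derivative. *)
rewrite -(cvg_lim _ lim)//; apply: lim_near_cst => //; near=> n.
rewrite /pseries /series/= [in X in _ * X + _ + _]/pseries_diffs.
transitivity (\sum_(0 <= k < n.+1) (nu + k%:R + 1) * k.+1%:R * bessel_coeff k.+1 * y ^+ k
   + \sum_(0 <= k < n.+1) bessel_coeff k * y ^+ k); last first.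
  by rewrite -big_split/= big1// => k _; rewrite bessel_coeff_rec mulNr addNr.
congr (_ + _).
rewrite mulr_sumr (_ : \sum_(0 <= k < n) _ =
  \sum_(0 <= k < n.+1) k%:R * k.+1%:R * bessel_coeff k.+1 * y ^+ k); last first.
  rewrite [RHS]big_nat_recl//= !mul0r add0r; apply: eq_bigr => k _.
  by rewrite /pseries_diffs exprS; ring.
rewrite mulr_sumr -big_split/=; apply: eq_bigr => k _.
by rewrite /pseries_diffs; ring.
Unshelve. all: by end_near. Qed.

Lemma Gamma_rising k :
  Gamma (nu + k%:R + 1) = Gamma (nu + 1) * \prod_(i < k) (nu + i%:R + 1).
Proof.
elim: k => [|k IH]; first by rewrite addr0 big_ord0 mulr1.
rewrite big_ord_recr/= mulrA -IH -natr1 addrA GammaD1 1?mulrC//.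
by rewrite ltrDr ltr_wpDr.
Qed.

Lemma besselJE x : 0 < x ->
  besselJ nu x = (Gamma (nu + 1))^-1 * (x / 2) `^ nu * reduced_bessel ((x / 2) ^+ 2).
Proof.
move=> x0; have x20 : 0 < x / 2 by rewrite divr_gt0.
set K := (Gamma (nu + 1))^-1 * (x / 2) `^ nu.
rewrite /besselJ; apply/cvg_lim => //.
rewrite (_ : series _ = fun n => K * pseries bessel_coeff ((x / 2) ^+ 2) n).
  by apply: cvgMr; exact: fact_bounded_cvg.
apply/funext => n; rewrite /pseries /series/= mulr_sumr; apply: eq_bigr => k _.
rewrite Gamma_rising /bessel_coeff powRD; last by rewrite (gt_eqF x20) implybT.
rewrite -natrM powR_mulrn ?ltW// exprM !invfM /K.
move: (_ ^+ k) (_ ^+ k) (\prod__ _)^-1 (k`!%:R^-1) => p q r t.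
by rewrite -!mulrA; ring.
Qed.

End bessel_series.

(** * The Riccati equation and the weight it integrates *)
Section riccati.
Variables (R : realType) (nu : R).
Hypothesis nu0 : 0 < nu.
Local Notation phi := (reduced_bessel nu).
Local Notation phi1 := (reduced_bessel1 nu).
Local Notation phi2 := (reduced_bessel2 nu).

(** This is (x J_nu' x / J_nu x - nu) / 2 at y = (x / 2)^2. *)
Definition logder (y : R) := y * phi1 y / phi y.

(** Up to the factor - phi^2, the derivative of [logder] once the second
    derivative of phi is eliminated by the differential equation. *)
Definition logder_slope (y : R) :=
  nu * phi y * phi1 y + phi y ^+ 2 + y * phi1 y ^+ 2.

Lemma is_derive_logder_slope (y : R) :
  is_derive y 1 logder_slope
    (nu * (phi1 y ^+ 2 + phi y * phi2 y) + 2 * phi y * phi1 y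
     + (phi1 y ^+ 2 + 2 * y * phi1 y * phi2 y)).
Proof.
have d0 := is_derive_reduced_bessel nu0 y; have d1 := is_derive_reduced_bessel1 nu0 y.
by rewrite /logder_slope; apply: is_derive_eq; rewrite /GRing.scale/=; ring.
Qed.

Lemma is_derive_logder (y : R) : phi y != 0 ->
  is_derive y 1 logder (- logder_slope y / phi y ^+ 2).
Proof.
move=> p0.
have d0 := is_derive_reduced_bessel nu0 y; have d1 := is_derive_reduced_bessel1 nu0 y.
have dV := is_deriveV p0 d0.
rewrite /logder; apply: is_derive_eq.
rewrite /GRing.scale/= /logder_slope.
have -> : y * phi2 y = - (nu + 1) * phi1 y - phi y.
  by have := reduced_bessel_ode nu0 y; lra.
by field.
Qed.

(** The function y^(nu + 1) M y, M being the slope, vanishes at 0 and has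
    derivative y^nu phi^2, a square with a positive factor. *)
Lemma logder_slope_ge0 (y : R) : 0 < y -> 0 <= logder_slope y.
Proof.
move=> y0.
pose F (t : R) := t `^ (nu + 1) * logder_slope t.
have dF (t : R) : 0 < t -> is_derive t 1 F (t `^ nu * phi t ^+ 2).
  move=> t0; have dM := is_derive_logder_slope t.
  have dP := is_derive1_powR (nu + 1) t0.
  rewrite /F; apply: is_derive_eq; rewrite /GRing.scale/= addrK.
  rewrite powRD ?(gt_eqF t0) ?implybT// powRr1 ?ltW// /logder_slope.
  have : t * phi2 t = - (nu + 1) * phi1 t - phi t.
    by have := reduced_bessel_ode nu0 t; lra.
  move: (t `^ nu) => q ode.
  transitivity (q * (t * (nu * phi1 t ^+ 2 + 2 * phi t * phi1 t + phi1 t ^+ 2)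
     + (t * phi2 t) * (nu * phi t + 2 * t * phi1 t)
     + (nu + 1) * (nu * phi t * phi1 t + phi t ^+ 2 + t * phi1 t ^+ 2))).
    by ring.
  by rewrite ode; ring.
have F0 : F 0 = 0 by rewrite /F powR0 ?mul0r// gt_eqF// addr_gt0.
have cW (t : R) : {for t, continuous logder_slope}.
  apply: differentiable_continuous; apply/derivable1_diffP.
  by have [] := is_derive_logder_slope t.
have : F 0 <= F y.
  apply: (@ger0_derive1_le_cc _ F 0 y) => //; rewrite ?in_itv/= ?lexx ?ltW//.
  - by move=> t; rewrite in_itv/= => /andP[t0 _]; have [] := dF t t0.
  - move=> t; rewrite in_itv/= => /andP[t0 _]; rewrite derive1E.
    by have [_ ->] := dF t t0; rewrite mulr_ge0 ?powR_ge0 ?sqr_ge0.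
  - move=> x; apply: cvgM; last exact/continuous_subspaceT.
    by apply: within_continuous_powR => //; rewrite addr_gt0.
by rewrite F0 /F pmulr_rge0 ?powR_gt0.
Qed.

Lemma logder_nincr (b : R) : (forall y, 0 <= y <= b -> phi y != 0) ->
  {in `[0, b] &, {homo logder : x y /~ x <= y}}.
Proof.
move=> pb; apply: ler0_derive1_le_cc.
- move=> x; rewrite in_itv/= => /andP[x0 xb].
  have xb' : 0 <= x <= b by rewrite !ltW.
  by have [] := is_derive_logder (pb x xb').
- move=> x; rewrite in_itv/= => /andP[x0 xb]; rewrite derive1E.
  have xb' : 0 <= x <= b by rewrite !ltW.
  have [_ ->] := is_derive_logder (pb x xb').
  by rewrite mulNr oppr_le0 divr_ge0 ?sqr_ge0// logder_slope_ge0.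
- apply: derivable_within_continuous => x; rewrite in_itv/= => xb.
  by have [] := is_derive_logder (pb x xb).
Qed.

Lemma logder0 : logder 0 = 0.
Proof. by rewrite /logder !mul0r. Qed.

End riccati.

Section potential.
Variables (R : realType) (nu m h c lam : R).
Hypotheses (nu0 : 0 < nu) (m0 : 0 < m) (h0 : 0 < h).
Hypothesis phi_neq0 : forall y, 0 <= y <= (c / m) ^+ 2 -> reduced_bessel nu y != 0.
Let B := (1 + nu * m) / 2.
Let A := (1 - nu ^+ 2 * m ^+ 2) / 4.
Hypothesis root : B + m * logder nu ((c / m) ^+ 2) = lam.

(** The coefficient of the equation z'' + w z = 0 solved by
    z s = sqrt s * J_nu ((2 c / m) (s / h)^(m / 2)). *)
Definition hweight (s : R) := A / s ^+ 2 + c ^+ 2 / h `^ m / s `^ (2 - m).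

(* The variable y = (x / 2)^2 for x = (2 c / m) (s / h)^(m / 2). *)
Let arg (s : R) := (c / m) ^+ 2 / h `^ m * s `^ m.
(* The logarithmic derivative of z. *)
Let p (s : R) := (B + m * logder nu (arg s)) / s.

Let arg_bnd s : 0 <= s <= h -> 0 <= arg s <= (c / m) ^+ 2.
Proof.
move=> /andP[s0 sh]; have H0 : 0 < h `^ m by rewrite powR_gt0.
apply/andP; split.
  by rewrite mulr_ge0 ?powR_ge0// divr_ge0 ?sqr_ge0 ?powR_ge0.
rewrite /arg -mulrA ler_piMr ?sqr_ge0// mulrC ler_pdivrMr// mul1r.
by apply: ge0_ler_powR => //; rewrite ?nnegrE//; exact: ltW.
Qed.

Let arg_h : arg h = (c / m) ^+ 2.
Proof. by rewrite /arg divfK// gt_eqF// powR_gt0. Qed.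

Let p_h : p h = lam / h. Proof. by rewrite /p arg_h root. Qed.

Let log_bnd s : 0 <= s <= h -> lam <= B + m * logder nu (arg s) <= B.
Proof.
move=> sh; have /andP[a0 a1] := arg_bnd sh.
have hom := logder_nincr nu0 phi_neq0.
have sq := sqr_ge0 (c / m).
apply/andP; split.
  rewrite -root lerD2l ler_pM2l//; apply: hom => //; rewrite in_itv/= ?a0//.
  by rewrite sq lexx.
rewrite gerDl pmulr_rle0// -(logder0 nu); apply: hom => //; rewrite in_itv/= ?a0//.
by rewrite lexx sq.
Qed.

Let hweightE s : 0 < s -> hweight s = (A + m ^+ 2 * arg s) / s ^+ 2.
Proof.
move=> s0; rewrite /hweight powRB ?(gt_eqF s0) ?implybT// powR_mulrn ?ltW//.
have hm : h `^ m != 0 by rewrite gt_eqF// powR_gt0.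
have sm : s `^ m != 0 by rewrite gt_eqF// powR_gt0.
by rewrite /arg; field; rewrite hm sm !gt_eqF.
Qed.

Let is_derive_p (s : R) : 0 < s <= h ->
  is_derive s 1 p (- hweight s - p s ^+ 2).
Proof.
move=> /andP[s0 sh].
have p0 : reduced_bessel nu (arg s) != 0 by apply/phi_neq0/arg_bnd; rewrite ltW.
have da : is_derive s 1 arg (m * arg s / s).
  have dP := is_derive1_powR m s0.
  rewrite /arg; apply: is_derive_eq; rewrite /GRing.scale/=.
  rewrite powRB ?(gt_eqF s0) ?implybT// powRr1 ?ltW//; ring.
have dl := is_derive_logder nu0 p0.
have dla : is_derive s 1 (logder nu \o arg) _ := is_derive1_comp dl da.
have sn0 : id s != 0 by rewrite gt_eqF.
have dV := is_deriveV sn0 (is_derive_id s 1).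
rewrite (_ : p = fun s => (B + m * (logder nu \o arg) s) * s^-1)//.
apply: is_derive_eq; rewrite /GRing.scale/=.
rewrite hweightE// /logder_slope /logder /=.
move: (arg s) p0 => y; rewrite /A /B.
move: (reduced_bessel nu y) (reduced_bessel1 nu y) => f0 f1 f0n0.
by field; rewrite f0n0 gt_eqF.
Qed.

Lemma hweight_continuous s : 0 < s -> {for s, continuous hweight}.
Proof.
move=> s0; apply: continuousD.
  apply: continuousM; first exact: cst_continuous.
  by apply: continuousV; [rewrite gt_eqF ?exprn_gt0|exact: exprn_continuous].
apply: continuousM; first exact: cst_continuous.
by apply: continuousV; [rewrite gt_eqF ?powR_gt0|exact: continuous_powR].
Qed.

Let p_continuous s : 0 < s <= h -> {for s, continuous p}.
Proof.
move=> sh; apply: differentiable_continuous; apply/derivable1_diffP.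
by have [] := is_derive_p sh.
Qed.

(** A smooth way to say that the integral of [hweight] over [s, h] is at most
    U s: a function V with continuous derivative - v, where v dominates the
    weight, has V s - V h at least that integral. *)
Definition weight_majorant (U : R -> R) := exists V v : R -> R,
  forall s, 0 < s <= h ->
  [/\ is_derive s 1 V (- v s), {for s, continuous v}, hweight s <= v s
    & V s - V h <= U s].

(** Dropping p^2 from the Riccati equation leaves p itself as primitive. *)
Lemma weight_majorant_le0 : weight_majorant (fun s => B / s - lam / h).
Proof.
exists p, (fun s => hweight s + p s ^+ 2) => s sh; have /andP[s0 sleh] := sh.
split.
- by rewrite opprD; exact: is_derive_p.
- apply: continuousD; first exact: hweight_continuous.
  rewrite (_ : (fun x => p x ^+ 2) = (fun x => p x * p x)).
    by apply: continuousM; exact: p_continuous.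
  by apply/funext => x; rewrite expr2.
- by rewrite lerDl sqr_ge0.
- rewrite p_h lerD2r /p ler_pM2r ?invr_gt0//.
  by have /andP[] : lam <= B + m * logder nu (arg s) <= B by rewrite log_bnd// ltW.
Qed.

(** Since p s >= lam / s >= 0, the square p^2 may be replaced by lam^2 / s^2,
    which integrates explicitly. *)
Lemma weight_majorant_ge0 : 0 <= lam ->
  weight_majorant (fun s => (B - lam ^+ 2) / s + (lam ^+ 2 - lam) / h).
Proof.
move=> lam0.
exists (fun s => p s - lam ^+ 2 / s).
exists (fun s => hweight s + p s ^+ 2 - (lam / s) ^+ 2) => s sh.
have /andP[s0 sleh] := sh.
have /andP[q0 q1] : lam <= B + m * logder nu (arg s) <= B.
  by rewrite log_bnd// ltW.
have sn0 : id s != 0 by rewrite gt_eqF.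
split.
- have dp := is_derive_p sh; have dV := is_deriveV sn0 (is_derive_id s 1).
  apply: is_derive_eq; rewrite /GRing.scale/=.
  by field.
- apply: continuousB; last first.
    rewrite (_ : (fun x => (lam / x) ^+ 2) = (fun x => lam ^+ 2 * x ^- 2)).
      apply: continuousM; first exact: cst_continuous.
      by apply: continuousV; [rewrite gt_eqF ?exprn_gt0|exact: exprn_continuous].
    by apply/funext => x; rewrite expr_div_n.
  apply: continuousD; first exact: hweight_continuous.
  rewrite (_ : (fun x => p x ^+ 2) = (fun x => p x * p x)).
    by apply: continuousM; exact: p_continuous.
  by apply/funext => x; rewrite expr2.
- have l0 : 0 <= lam / s by rewrite divr_ge0// ltW.
  have lp : lam / s <= p s by rewrite /p ler_pM2r ?invr_gt0.
  by rewrite -addrA lerDl subr_ge0 lerXn2r// nnegrE// (le_trans l0).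
- rewrite p_h /p; have : (B + m * logder nu (arg s)) / s <= B / s.
    by rewrite ler_pM2r ?invr_gt0.
  by rewrite !mulrBl; lra.
Qed.

End potential.

(** * Meaning of the root condition *)
Section bessel_root.
Variables (R : realType) (nu m lam c : R).
Local Notation phi := (reduced_bessel nu).
Local Notation phi1 := (reduced_bessel1 nu).
Hypotheses (nu0 : 0 < nu) (m0 : 0 < m) (root : is_bessel_root nu m lam c).

Let besselJ_neq0 x : 0 < x <= 2 / m * c -> besselJ nu x != 0.
Proof.
case: root => _ _ czero /andP[x0 xc]; apply/eqP => Jx.
have : bessel_zero nu <= x.
  by apply: ge_inf => //; exists 0 => y [y0 _]; exact: ltW.
by rewrite leNgt (le_lt_trans xc czero).
Qed.

Let c0 : 0 < c. Proof. by case: root => _ + _; rewrite pmulr_rgt0// divr_gt0. Qed.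

(** A zero y > 0 would make 2 sqrt y a positive zero of J_nu not beyond
    2 c / m, which lies strictly before the first one. *)
Lemma reduced_bessel_neq0 y : 0 <= y <= (c / m) ^+ 2 -> phi y != 0.
Proof.
move=> /andP[]; rewrite le_eqVlt => /predU1P[<- _|y0 yc].
  by rewrite reduced_bessel0 oner_neq0.
have s0 : 0 < Num.sqrt y by rewrite sqrtr_gt0.
have : besselJ nu (2 * Num.sqrt y) != 0.
  apply: besselJ_neq0; rewrite mulr_gt0//= mulrAC -mulrA ler_pM2l//.
  have cm0 : 0 <= c / m by rewrite divr_ge0// ltW.
  by rewrite -(ger0_norm cm0) -sqrtr_sqr ler_wsqrtr.
rewrite besselJE ?mulr_gt0// [2 * _]mulrC mulfK// sqr_sqrtr ?ltW//.
by rewrite mulf_eq0 negb_or => /andP[].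
Qed.

(** The equation defining c, divided by J_nu (2 c / m): it prescribes the
    logarithmic derivative of J_nu there. *)
Lemma bessel_root_logder :
  (1 + nu * m) / 2 + m * logder nu ((c / m) ^+ 2) = lam.
Proof.
have [rootE x0 _] := root; set x := 2 / m * c in rootE x0.
have xE : x / 2 = c / m by rewrite /x; field; rewrite gt_eqF.
have cm0 : 0 < c / m by rewrite divr_gt0.
have := @besselJ_neq0 x; rewrite x0 lexx => /(_ isT) Jx.
pose K := (Gamma (nu + 1))^-1.
(* A zero value of Gamma (nu + 1) would make J_nu vanish at x. *)
have K0 : K != 0.
  by move: Jx; rewrite besselJE// -mulrA mulf_eq0 negb_or => /andP[].
have p0 : phi ((c / m) ^+ 2) != 0.
  by apply: reduced_bessel_neq0; rewrite sqr_ge0 lexx.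
have dJ : derive1 (besselJ nu) x = K * (c / m) `^ nu / (c / m)
    * (nu / 2 * phi ((c / m) ^+ 2) + (c / m) ^+ 2 * phi1 ((c / m) ^+ 2)).
  pose H (t : R) := t / 2.
  have dH : is_derive x 1 H 2^-1.
    by rewrite /H; apply: is_derive_eq; rewrite /GRing.scale/=; ring.
  have Hx : H x = c / m by [].
  have dP0 : is_derive (c / m) 1 (fun z : R => z `^ nu) (nu * (c / m) `^ (nu - 1)).
    exact: is_derive1_powR.
  rewrite -Hx in dP0; have dP := is_derive1_comp dP0 dH.
  have dF0 := is_derive_reduced_bessel nu0 ((c / m) ^+ 2).
  have dS : is_derive x 1 (fun t => (t / 2) ^+ 2) (c / m).
    apply: is_derive_eq; rewrite /GRing.scale/= xE; field; by rewrite gt_eqF.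
  have dF : is_derive x 1 (phi \o (fun t => (t / 2) ^+ 2))
      (phi1 ((c / m) ^+ 2) * (c / m)).
    by apply: is_derive1_comp; rewrite xE.
  have dJ0 : is_derive x 1
    (fun t => K * ((fun z : R => z `^ nu) \o H) t
              * (phi \o (fun t => (t / 2) ^+ 2)) t)
    (K * (c / m) `^ nu / (c / m)
    * (nu / 2 * phi ((c / m) ^+ 2) + (c / m) ^+ 2 * phi1 ((c / m) ^+ 2))).
    apply: is_derive_eq; rewrite /GRing.scale/= Hx xE.
    rewrite powRB ?(gt_eqF cm0) ?implybT// powRr1 ?ltW//.
    by field; rewrite !gt_eqF.
  rewrite derive1E (@near_eq_derive _ _ _ _
    (fun t => K * ((fun z : R => z `^ nu) \o H) t
              * (phi \o (fun t => (t / 2) ^+ 2)) t))//.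
    by have [_ ->] := dJ0.
  near=> t; rewrite besselJE//; near: t; exact: lt_nbhsr.
move: rootE; rewrite dJ besselJE// xE -/K /logder.
move: (phi _) (phi1 _) p0 => f f1 f0 E.
have P0 : (c / m) `^ nu != 0 by rewrite gt_eqF ?powR_gt0.
have E1 : K * (c / m) `^ nu *
    ((1 - 2 * lam + nu * m) * f + 2 * m * (c / m) ^+ 2 * f1) = 0.
  by rewrite -E; field; rewrite !gt_eqF.
have : (1 - 2 * lam + nu * m) * f + 2 * m * (c / m) ^+ 2 * f1 = 0.
  by move/eqP: E1; rewrite mulf_eq0 (negbTE (mulf_neq0 K0 P0)) => /eqP.
move=> E2; have -> : (c / m) ^+ 2 * f1 = - (1 - 2 * lam + nu * m) * f / (2 * m).
  apply: (@mulfI _ (2 * m)); first by rewrite gt_eqF// mulr_gt0.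
  rewrite [RHS]mulrC divfK; last by rewrite gt_eqF// mulr_gt0.
  by rewrite mulrA; lra.
by field; rewrite f0 gt_eqF.
Unshelve. all: by end_near. Qed.

End bessel_root.

(** * Finite families of non-overlapping intervals *)
Section interval_lists.
Variable R : realType.
Implicit Types (p q r : R * R) (l : seq (R * R)).

Definition apart p q := (p.2 <= q.1) || (q.2 <= p.1).

Definition proper_itvs l := all (fun p => p.1 <= p.2) l && pairwise apart l.

Definition within_itv (a b : R) l := all (fun p => (a <= p.1) && (p.2 <= b)) l.

Definition total_length l := \sum_(p <- l) (p.2 - p.1).

Lemma apartC p q : apart p q = apart q p. Proof. by rewrite /apart orbC. Qed.

Lemma proper_itvs_cat l1 l2 : proper_itvs (l1 ++ l2) =
  [&& proper_itvs l1, proper_itvs l2 & allrel apart l1 l2].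
Proof.
rewrite /proper_itvs all_cat pairwise_cat.
by case: (all _ l1); case: (all _ l2); case: (allrel _ _ _);
  case: (pairwise _ l1); case: (pairwise _ l2).
Qed.

Lemma total_length_cat l1 l2 :
  total_length (l1 ++ l2) = total_length l1 + total_length l2.
Proof. by rewrite /total_length big_cat. Qed.

(** Adding an interval to a family while keeping it non-overlapping: whatever
    overlaps the newcomer is merged with it, and the merged interval is
    inserted in its place.  Merging does not increase the total length. *)
Fixpoint insert_itv q l := if l is p :: t then
    if apart p q then p :: insert_itv q t
    else insert_itv (Num.min p.1 q.1, Num.max p.2 q.2) t
  else [:: q].

(** Two overlapping intervals that are apart from p lie on the same side
    of p. *)
Lemma apart_merge p q r : p.1 <= p.2 -> ~~ apart r q -> apart p r -> apart p q ->
  apart p (Num.min r.1 q.1, Num.max r.2 q.2).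
Proof.
rewrite /apart negb_or -!ltNge => pp /andP[qr rq] pr pq /=.
rewrite le_min ge_max.
case/orP: pr => pr; case/orP: pq => pq; rewrite pr pq ?orbT//=; exfalso.
- by move: qr rq pr pq pp; lra.
- by move: qr rq pr pq pp; lra.
Qed.

Lemma apart_insert p q l : p.1 <= p.2 -> apart p q -> all (apart p) l ->
  all (apart p) (insert_itv q l).
Proof.
move=> pp; elim: l q => [|r l IH] q pq /=; first by rewrite pq.
move=> /andP[pr pl]; case: ifPn => [_|rq] /=; first by rewrite pr IH.
by apply: IH => //; exact: apart_merge.
Qed.

Lemma insert_ordered q l : q.1 <= q.2 -> all (fun p => p.1 <= p.2) l ->
  all (fun p => p.1 <= p.2) (insert_itv q l).
Proof.
elim: l q => [|r l IH] q qq /=; first by rewrite qq.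
move=> /andP[rr ll]; case: ifPn => _ /=; first by rewrite rr IH.
by apply: IH => //=; rewrite le_max !ge_min rr.
Qed.

Lemma proper_itvs_insert q l : q.1 <= q.2 -> proper_itvs l ->
  proper_itvs (insert_itv q l).
Proof.
move=> qq /andP[lp la]; rewrite /proper_itvs insert_ordered//=.
elim: l q qq lp la => [//|r l IH] q qq /= /andP[rr lp] /andP[ra la].
case: ifPn => [rq|rq] /=; first by rewrite apart_insert// IH.
by rewrite IH//= le_max !ge_min rr.
Qed.

Lemma total_length_insert q l : q.1 <= q.2 -> all (fun p => p.1 <= p.2) l ->
  total_length (insert_itv q l) <= q.2 - q.1 + total_length l.
Proof.
rewrite /total_length; elim: l q => [|r l IH] q qq /=.
  by rewrite big_seq1 big_nil addr0.
move=> /andP[rr lp].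
rewrite [X in _ + X]big_cons; case: ifPn => rq /=.
  by rewrite big_cons addrCA lerD2l IH.
apply: (le_trans (IH _ _ lp)) => /=; first by rewrite le_max !ge_min rr.
rewrite addrA lerD2r.
move: rq; rewrite /apart negb_or -!ltNge => /andP[].
by case: (leP r.1 q.1); case: (leP r.2 q.2); move: rr qq; lra.
Qed.

(** Intervals are taken open on the left and closed on the right, as those that
    generate the Stieltjes measures. *)
Definition cover l : set R := [set x | exists2 p, p \in l & p.1 < x <= p.2].

Lemma cover_cons p l : cover (p :: l) = `]p.1, p.2]%classic `|` cover l.
Proof.
apply/seteqP; split => x /=.
  move=> [q]; rewrite inE => /predU1P[->|ql] qx; first by left; rewrite in_itv/=.
  by right; exists q.
move=> [|[q ql qx]]; first by rewrite in_itv/= => px; exists p; rewrite ?inE ?eqxx.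
by exists q; rewrite // inE ql orbT.
Qed.

Lemma cover_nil : cover [::] = set0.
Proof. by apply/seteqP; split => // x []. Qed.

Lemma cover_insert q l : cover (q :: l) `<=` cover (insert_itv q l).
Proof.
elim: l q => [q x //|r l IH q x [p]]; rewrite !inE /= => pl px.
case: ifPn => rq.
  move: pl; rewrite orbCA => /orP[/eqP pr|pl].
    by exists r; rewrite ?inE ?eqxx// -pr.
  have [|p' p'l p'x] := IH q x; first by exists p; rewrite ?inE.
  by exists p' => //; rewrite inE p'l orbT.
apply: IH.
case/or3P: pl => [/eqP pq|/eqP pr|pl].
- exists (Num.min r.1 q.1, Num.max r.2 q.2); rewrite ?inE ?eqxx//=.
  by move: px; rewrite pq gt_min le_max => /andP[-> ->]; rewrite !orbT.
- exists (Num.min r.1 q.1, Num.max r.2 q.2); rewrite ?inE ?eqxx//=.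
  by move: px; rewrite pr gt_min le_max => /andP[-> ->].
- by exists p => //; rewrite inE pl orbT.
Qed.

End interval_lists.

Section ac_lists.
Variables (R : realType) (a b : R) (f : R -> R).
Implicit Types (l : seq (R * R)).

Definition increments l := \sum_(p <- l) `|f p.2 - f p.1|.

(** The definition indexes families by ordinals; lists are easier to cut, refine
    and merge. *)
Lemma abs_continuous_lists : abs_continuous a b f ->
  forall e, 0 < e -> exists2 d, 0 < d & forall l, within_itv a b l ->
    proper_itvs l -> total_length l < d -> increments l < e.
Proof.
move=> ac e e0; have [d d0 acd] := ac e e0; exists d => // l lab lp ld.
have := acd (size l) (fun i => (nth (0, 0) l i).1) (fun i => (nth (0, 0) l i).2).
rewrite -(big_mkord xpredT (fun i => (nth (0, 0) l i).2 - (nth (0, 0) l i).1)).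
rewrite -(big_mkord xpredT (fun i => `|f (nth (0, 0) l i).2 - f (nth (0, 0) l i).1|)).
rewrite -(big_nth (0, 0) xpredT (fun p => p.2 - p.1)).
rewrite -(big_nth (0, 0) xpredT (fun p => `|f p.2 - f p.1|)); apply => //.
- move=> i; have il : nth (0, 0) l i \in l by rewrite mem_nth.
  by have /andP[-> ->] := allP lab _ il; have /andP[/allP/(_ _ il) -> _] := lp.
- apply/trivIsetP => i j _ _ ij.
  wlog ltij : i j ij / (i < j)%N.
    move=> H; have [/H->//|ji|/val_inj E] := ltngtP i j.
      by rewrite setIC; apply: H; rewrite // eq_sym.
    by rewrite E eqxx in ij.
  have /andP[_ /(pairwiseP (0, 0))/(_ i j)] := lp.
  rewrite !inE !ltn_ord => /(_ isT isT ltij); rewrite /apart => ap.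
  apply/seteqP; split => // x [] /=; rewrite !in_itv/= => /andP[x1 x2] /andP[x3 x4].
  by move: ap x1 x2 x3 x4 => /orP[]; lra.
Qed.

End ac_lists.

(** * Total variation of an absolutely continuous function *)
Section total_variation_lists.
Variables (R : realType) (f : R -> R).
Implicit Types (l : seq (R * R)) (s : seq R).

Fixpoint steps (x : R) s := if s is z :: s' then (x, z) :: steps z s' else [::].

Lemma steps_within x s : path <%R x s ->
  forall p, p \in steps x s -> [/\ x <= p.1, p.1 <= p.2 & p.2 <= last x s].
Proof.
elim: s x => [//|z s IH] x /= /andP[xz zs] p; rewrite inE => /predU1P[->/=|pz].
  split; [exact: lexx|exact: ltW|].
  elim: s z zs {IH xz} => [z _ //|w s IH z] /= /andP[zw ws].
  by rewrite (le_trans (ltW zw))// IH.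
have [zp pp ps] := IH _ zs _ pz; split => //; exact: le_trans (ltW xz) zp.
Qed.

Lemma proper_steps x s : path <%R x s -> proper_itvs (steps x s).
Proof.
elim: s x => [//|z s IH] x /= /andP[xz zs].
rewrite -cat1s proper_itvs_cat IH// /proper_itvs/= ltW//=.
apply/allrelP => p q; rewrite inE => /eqP-> /(steps_within zs)[zq _ _].
by rewrite /apart zq.
Qed.

Lemma total_length_steps x s : total_length (steps x s) = last x s - x.
Proof.
rewrite /total_length; elim: s x => [|z s IH] x /=; first by rewrite big_nil subrr.
by rewrite big_cons IH/=; lra.
Qed.

Lemma variation_steps x y s : variation x y f s = increments f (steps x s).
Proof.
rewrite /variation /increments; elim: s x => [|z s IH] x /=.
  by rewrite big_nil big_geq.
by rewrite big_cons/= big_nat_recl//= -IH.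
Qed.

Lemma increments_cat l1 l2 :
  increments f (l1 ++ l2) = increments f l1 + increments f l2.
Proof. by rewrite /increments big_cat. Qed.

(** The modulus of absolute continuity bounds sums of total variations, not only
    sums of increments.  The intervals are treated one at a time: the total
    variation over one of them is a supremum over subdivisions, and replacing
    the interval by any of its subdivisions leaves the family proper, with the
    same total length. *)
Lemma total_variation_lists (a b d e : R) :
  (forall l, within_itv a b l -> proper_itvs l -> total_length l < d ->
    increments f l < e) ->
  forall l1 l2, within_itv a b (l1 ++ l2) -> proper_itvs (l1 ++ l2) ->
    total_length (l1 ++ l2) < d ->
    (\sum_(p <- l1) total_variation p.1 p.2 f + (increments f l2)%:E <= e%:E)%E.
Proof.
move=> ac; elim=> [|p l1 IH] l2.
  by move=> lab lp ld; rewrite big_nil add0e lee_fin ltW// ac.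
rewrite cat_cons -cat1s => lab lp ld.
move: (lab); rewrite /within_itv all_cat => /andP[/andP[/andP[ap pb] _] lab'].
move: (lp); rewrite proper_itvs_cat => /and3P[]; rewrite /proper_itvs/= !andbT.
move=> pp lp' /allrelP plp.
(* The interval p is replaced by its subdivision s, moved to the second list. *)
have IHl s : itv_partition p.1 p.2 s ->
    (\sum_(p <- l1) total_variation p.1 p.2 f
     + (variation p.1 p.2 f s + increments f l2)%:E <= e%:E)%E.
  move=> [ps /eqP slast]; have sw := steps_within ps; rewrite slast in sw.
  rewrite variation_steps -increments_cat; apply: IH.
  - rewrite /within_itv !all_cat; move: lab'; rewrite all_cat => /andP[-> ->].
    rewrite andbT; apply/allP => q /sw[pq qq qp].
    by rewrite (le_trans ap)//= (le_trans qp).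
  - have pq q t : q \in steps p.1 s -> t \in l1 ++ l2 -> apart q t.
      move=> /sw[pq qq qp] tl; have := plp p t (mem_head _ _) tl.
      rewrite /apart => /orP[pt|tp]; first by rewrite (le_trans qp).
      by rewrite (le_trans tp)// orbT.
    move: lp'; rewrite -/(proper_itvs _) !proper_itvs_cat => /and3P[-> -> /allrelP a12].
    rewrite proper_steps//=; apply/andP; split; apply/allrelP => q t.
      by move=> qs tl; apply: pq => //; rewrite mem_cat tl orbT.
    move=> ql; rewrite mem_cat => /orP[ts|tl]; last exact: a12.
    by rewrite apartC; apply: pq => //; rewrite mem_cat ql.
  - move: ld; rewrite !total_length_cat total_length_steps slast.
    by rewrite /total_length big_seq1; lra.
have [s0 s0p] : exists s, itv_partition p.1 p.2 s.
  move: pp; rewrite le_eqVlt => /predU1P[->|pp]; first by exists [::]; split.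
  by exists [:: p.2]; exact: itv_partition1.
rewrite big_cons; set S := (\sum_(_ <- _) _)%E.
have S0 : (0 <= S)%E.
  rewrite /S big_seq; apply: sume_ge0 => q ql; apply: total_variation_ge0.
  by have /andP[/allP/(_ q)] := lp'; rewrite mem_cat ql => /(_ isT).
have Sfin : S \is a fin_num.
  rewrite ge0_fin_numE//; have := IHl _ s0p; rewrite -/S.
  by case: (S) S0 => //= r _ _; rewrite ltry.
rewrite -/S in IHl; rewrite -(fineK Sfin) in IHl *.
rewrite -addeA addeC -EFinD -leeBrDl//; apply: ge_ereal_sup => _ [v [s sp <-] <-].
have := IHl s sp; rewrite -EFinD -EFinB !lee_fin; lra.
Qed.

End total_variation_lists.

Section ac_variation.
Variables (R : realType) (a b : R) (f : R -> R).
Hypotheses (ab : a <= b) (ac : abs_continuous a b f).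

Let ac_tv (e : R) : 0 < e -> exists2 d, 0 < d & forall l, within_itv a b l ->
  proper_itvs l -> total_length l < d ->
  (\sum_(p <- l) total_variation p.1 p.2 f <= e%:E)%E.
Proof.
move=> e0; have [d d0 acd] := abs_continuous_lists ac e0.
exists d => // l lab lp ld.
have := @total_variation_lists _ _ _ _ _ _ acd l [::].
by rewrite cats0 /increments big_nil adde0; exact.
Qed.

(** Cut [a, b] in pieces of length d / 2, where d corresponds to e = 1: the total
    variation over each piece is at most 1. *)
Lemma abs_continuous_bv : bounded_variation a b f.
Proof.
apply/bounded_variationP => //.
have [d d0 tvd] := ac_tv ltr01.
pose x k := Num.min (a + k%:R * (d / 2)) b.
have ax k : a <= x k <= b.
  by rewrite /x le_min ge_min lexx orbT ab lerDl mulr_ge0// divr_ge0// ltW.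
have xx k : x k <= x k.+1.
  rewrite /x le_min !ge_min lexx !orbT andbT lerD2l ler_pM2r ?divr_gt0//.
  by rewrite ler_nat leqnSn.
have tvx k : (total_variation a (x k) f <= k%:R%:E)%E.
  elim: k => [|k IH].
    by rewrite /x mul0r addr0 (min_idPl ab) total_variationxx.
  have /andP[ak kb] := ax k; have /andP[_ k1b] := ax k.+1.
  rewrite (total_variationD f ak (xx k)) -natr1 EFinD; apply: leeD => //.
  have xS : x k.+1 - x k < d.
    have -> : x k.+1 = Num.min ((a + k%:R * (d / 2)) + d / 2) b.
      by rewrite /x -natr1 mulrDl mul1r addrA.
    rewrite /x; move: (a + _) => t.
    by case: (leP (t + d / 2) b); case: (leP t b); lra.
  have := tvd [:: (x k, x k.+1)].
  rewrite /within_itv /proper_itvs /total_length/= !big_seq1/= ak k1b xx.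
  by move=> /(_ isT isT xS).
have [k kb] : exists k, x k = b.
  exists (Num.bound ((b - a) / (d / 2))); apply/min_idPr.
  rewrite -lerBlDl -ler_pdivrMr ?divr_gt0// ltW// archi_boundP//.
  by rewrite divr_ge0 ?subr_ge0 ?divr_ge0// ltW.
rewrite ge0_fin_numE ?total_variation_ge0//.
by have := tvx k; rewrite kb => /le_lt_trans; apply; rewrite ltry.
Qed.

Definition cumvar (x : R) := fine (total_variation a x f).

Lemma cumvarB x y : a <= x -> x <= y -> y <= b ->
  total_variation x y f = (cumvar y - cumvar x)%:E.
Proof.
move=> ax xy yb; have bv := abs_continuous_bv.
have ay := le_trans ax xy; have xb := le_trans xy yb.
have fx : total_variation a x f \is a fin_num.
  by apply/bounded_variationP => //; exact: bounded_variationl bv.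
have fy : total_variation a y f \is a fin_num.
  by apply/bounded_variationP => //; exact: bounded_variationl bv.
rewrite EFinB !fineK// (total_variationD f ax xy) addeAC subee ?add0e//.
Qed.

Lemma cumvar_ge x y : a <= x -> x <= y -> y <= b ->
  `|f y - f x| <= cumvar y - cumvar x.
Proof.
by move=> ax xy yb; rewrite -lee_fin -cumvarB//; exact: total_variation_ge.
Qed.

Lemma cumvar_ac (e : R) : 0 < e -> exists2 d, 0 < d & forall l,
  within_itv a b l -> proper_itvs l -> total_length l < d ->
  \sum_(p <- l) (cumvar p.2 - cumvar p.1) <= e.
Proof.
move=> /ac_tv[d d0 acd]; exists d => // l lab lp ld.
have := acd l lab lp ld; rewrite (eq_big_seq (fun p => (cumvar p.2 - cumvar p.1)%:E)).
  by rewrite sumEFin lee_fin.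
move=> p pl /=; have /andP[ap pb] := allP lab _ pl.
by have /andP[/allP/(_ p pl) pp _] := lp; exact: cumvarB.
Qed.

End ac_variation.

(** * Stieltjes measures dominated by Lebesgue measure *)
Section stieltjes.
Variables (R : realType) (F : cumulative R R).
Local Notation mu := (@lebesgue_measure R).
Local Notation muF := (lebesgue_stieltjes_measure F).

Lemma stieltjes_itvoc (G : cumulative R R) (x y : R) : x <= y ->
  lebesgue_stieltjes_measure G `]x, y]%classic = (G y - G x)%:E.
Proof.
move=> xy; rewrite /lebesgue_stieltjes_measure /measure_extension.
by rewrite measurable_mu_extE/= ?wlength_itv_bnd//; exact: is_ocitv.
Qed.

Lemma measurable_cover_list (l : seq (R * R)) : measurable (cover l : set R).
Proof.
elim: l => [|p l IH]; first by rewrite cover_nil.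
by rewrite cover_cons; exact: measurableU.
Qed.

Lemma stieltjes_cover_le (l : seq (R * R)) : proper_itvs l ->
  (muF (cover l) <= (\sum_(p <- l) (F p.2 - F p.1))%:E)%E.
Proof.
move=> /andP[+ _]; elim: l => [_|p l IH /= /andP[pp lp]].
  by rewrite cover_nil measure0 big_nil.
rewrite cover_cons big_cons EFinD -stieltjes_itvoc//.
apply: le_trans (measureU2 _ _ _) _ => //; first exact: measurable_cover_list.
by apply: leeD => //; exact: IH.
Qed.

(** A null set has a countable cover by half-open intervals of small total
    length.  Merging the first n of them gives a proper family to which the
    modulus applies, so the Stieltjes measure of their union is small; let n
    tend to infinity. *)
Lemma stieltjes_dominated :
  (forall e, 0 < e -> exists2 d, 0 < d & forall l : seq (R * R),
    proper_itvs l -> total_length l < d -> \sum_(p <- l) (F p.2 - F p.1) <= e) ->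
  forall A : set R, measurable A -> mu A = 0%E -> muF A = 0%E.
Proof.
move=> ac A mA A0; apply/eqP; rewrite eq_le measure_ge0 andbT.
apply/lee_addgt0Pr => e e0; rewrite add0e.
have [d d0 acd] := ac e e0.
have : (mu A < d%:E)%E by rewrite A0 lte_fin.
rewrite {1}/lebesgue_measure {1}/lebesgue_stieltjes_measure {1}/measure_extension.
move=> /ereal_inf_lt[_ [I [mI AI] <-] Id].
have /choice[p pI] : forall k, exists q : R * R, q.1 <= q.2 /\ I k = `]q.1, q.2]%classic.
  move=> k; have /ocitvP[->|[q q12 ->]] := mI k.
    by exists (0, 0); split => //; rewrite set_itvoc0.
  by exists q; split => //; exact: ltW.
pose L n := iteri n (fun k l => insert_itv (p k) l) [::].
have Lp n : proper_itvs (L n).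
  by elim: n => //= n IH; apply: proper_itvs_insert => //; have [] := pI n.
have Llen n : total_length (L n) <= \sum_(0 <= k < n) ((p k).2 - (p k).1).
  elim: n => /= [|n IH]; first by rewrite /total_length big_nil big_geq.
  apply: le_trans (total_length_insert _ _) _; first by have [] := pI n.
    by have /andP[] := Lp n.
  by rewrite big_nat_recr//= [leRHS]addrC lerD2l.
have Ld n : total_length (L n) < d.
  rewrite -lte_fin (le_lt_trans _ Id)//.
  apply: (@le_trans _ _ (\sum_(0 <= k < n) wlength idfun (I k))%E); last first.
    by apply: nneseries_lim_ge => k _ _; have [_ ->] := pI k; exact: wlength_itv_ge0.
  rewrite (le_trans (_ : _ <= (\sum_(0 <= k < n) ((p k).2 - (p k).1))%:E)%E)//.
    by rewrite lee_fin.
  rewrite -sumEFin; apply: lee_sum => k _; have [pp ->] := pI k.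
  by rewrite wlength_itv_bnd.
have Lcov n k : (k < n)%N -> I k `<=` cover (L n).
  elim: n => // n IH; rewrite ltnS leq_eqVlt => /predU1P[->|kn] x Ix /=;
    apply: cover_insert.
    exists (p n); first exact: mem_head.
    by move: Ix; have [_ ->] := pI n; rewrite /= in_itv.
  by have [q ql qx] := IH kn x Ix; exists q => //; rewrite inE ql orbT.
pose U n : set (measurableTypeR R) := \big[setU/set0]_(k < n) I k.
have mU n : measurable (U n).
  apply: bigsetU_measurable => k _; have [_ ->] := pI k; exact: measurable_itv.
have mUU : measurable (\bigcup_n U n) by apply: bigcup_measurable => n _.
have ndU m n : (m <= n)%N -> U m `<=` U n by move=> mn; exact: subset_bigsetU.
apply: (@le_trans _ _ (muF (\bigcup_n U n))).
  apply: le_measure => //; rewrite ?inE//.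
  by apply: subset_trans AI _ => x [k _ Ikx]; exists k.+1 => //;
    rewrite /U big_ord_recr; right.
have Ulim : muF (U n) @[n --> \oo] --> muF (\bigcup_n U n).
  apply: nondecreasing_cvg_mu => // m n mn; apply/subsetPset; exact: ndU.
rewrite -(cvg_lim _ Ulim)//; apply: lime_le.
  by apply: cvgP Ulim.
apply: nearW => n; apply: (@le_trans _ _ (muF (cover (L n)))); last first.
  by apply: le_trans (stieltjes_cover_le (Lp n)) _; rewrite lee_fin acd.
apply: le_measure; rewrite ?inE//; first exact: measurable_cover_list.
by rewrite /U -bigcup_mkord => x [k /= kn]; exact: Lcov.
Qed.

End stieltjes.

Section density.
Variables (R : realType) (a b : R).
Hypothesis ab : a < b.
Local Notation mu := (@lebesgue_measure R).

(** Composing with the projection onto [a, b] extends a function on [a, b] to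
    the line, keeping it monotone and absolutely continuous, as Stieltjes
    measures require. *)
Definition clamp (x : R) := Num.max a (Num.min x b).

Lemma clamp_itv x : a <= clamp x <= b.
Proof. by rewrite /clamp le_max lexx/= ge_max ge_min lexx orbT ltW. Qed.

Lemma clamp_id x : a <= x <= b -> clamp x = x.
Proof. by move=> /andP[ax xb]; rewrite /clamp (min_idPl xb) (max_idPr ax). Qed.

Lemma clamp_le x y : x <= y -> clamp x <= clamp y.
Proof.
move=> xy; rewrite /clamp ge_max !le_max lexx/=; apply/orP; right.
by rewrite le_min !ge_min xy lexx orbT.
Qed.

Lemma clamp_contract x y : x <= y -> clamp y - clamp x <= y - x.
Proof.
move=> xy; rewrite /clamp; have [?|?] := leP x b; have [?|?] := leP y b;
  by have [?|?] := leP a x; have [?|?] := leP a y; have [?|?] := leP a b; lra.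
Qed.

(** Radon-Nikodym for the Stieltjes measure of G, restricted to ]a, b] to be
    finite. *)
Lemma monotone_ac_density (G : R -> R) :
  {in `[a, b] &, {homo G : x y / x <= y}} ->
  (forall e, 0 < e -> exists2 d, 0 < d & forall l, within_itv a b l ->
    proper_itvs l -> total_length l < d -> \sum_(p <- l) (G p.2 - G p.1) <= e) ->
  exists2 g : R -> R, mu.-integrable [set: R] (EFin \o g) &
    forall x y, a <= x -> x <= y -> y <= b ->
      (\int[mu]_(t in `]x, y]) (g t)%:E = (G y - G x)%:E)%E.
Proof.
move=> ndG acG.
pose Gc x := G (clamp x).
have nd : {homo Gc : x y / x <= y}.
  by move=> x y xy; apply: ndG; rewrite ?in_itv/= ?clamp_itv// clamp_le.
have acGc e : 0 < e -> exists2 d, 0 < d & forall l, proper_itvs l ->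
    total_length l < d -> \sum_(p <- l) (Gc p.2 - Gc p.1) <= e.
  move=> /acG[d d0 acd]; exists d => // l lp ld.
  pose cl p := (clamp p.1, clamp p.2).
  have := acd (map cl l); rewrite big_map; apply.
  - by apply/allP => _ /mapP[p _ ->]/=; have /andP[-> _] := clamp_itv p.1;
      have /andP[_ ->] := clamp_itv p.2.
  - move: lp => /andP[/allP lp lap]; apply/andP; split.
      by apply/allP => _ /mapP[p pl ->]/=; apply: clamp_le; exact: lp.
    rewrite pairwise_map; apply: sub_pairwise lap => p q.
    by rewrite /apart/= => /orP[/clamp_le->//|/clamp_le->]; rewrite orbT.
  - apply: le_lt_trans ld; rewrite /total_length big_map big_seq [leRHS]big_seq.
    apply: ler_sum => p pl; apply: clamp_contract.
    by move: lp => /andP[/allP/(_ p pl)].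
have rc x : Gc @ at_right x --> Gc x.
  apply/cvgrPdist_le => e /acGc[d d0 acd]; near=> y.
  have xy : x <= y by apply: ltW; near: y; exact: nbhs_right_gt.
  have := acd [:: (x, y)]; rewrite /proper_itvs /total_length/= !big_seq1/= xy.
  rewrite distrC ger0_norm ?subr_ge0 ?nd//; apply => //.
  by rewrite ltrBlDl; near: y; apply: nbhs_right_lt; rewrite ltrDl.
pose F : cumulative R R := HB.pack Gc (isCumulative.Build _ _ _ Gc nd rc).
pose muF := lebesgue_stieltjes_measure F.
have muFab : (muF `]a, b]%classic < +oo)%E.
  by rewrite /muF stieltjes_itvoc ?ltW// ltry.
have mab : measurable (`]a, b]%classic : set (measurableTypeR R)).
  exact: measurable_itv.
pose nu : {finite_measure set (measurableTypeR R) -> \bar R} := mfrestr mab muFab.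
have numu : charge_of_finite_measure nu `<< mu.
  apply/null_content_dominatesP => A mA A0.
  have nA : muF A = 0%E by exact: stieltjes_dominated.
  apply/eqP; rewrite eq_le measure_ge0 andbT -nA.
  by apply: le_measure; rewrite ?inE//; exact: measurableI.
pose g := Radon_Nikodym (charge_of_finite_measure nu) mu.
have gfin t : g t \is a fin_num by exact: Radon_Nikodym_fin_num.
have gE : EFin \o (fine \o g) = g by apply/funext => t /=; rewrite fineK.
exists (fine \o g); first by rewrite gE; exact: Radon_Nikodym_integrable.
move=> x y ax xy yb.
transitivity (\int[mu]_(t in `]x, y]) g t)%E.
  by apply: eq_integral => t _ /=; rewrite fineK.
rewrite -Radon_Nikodym_integral//.
rewrite -[LHS]/(muF (`]x, y]%classic `&` `]a, b]%classic)) setIidl; last first.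
  move=> t /=; rewrite !in_itv/= => /andP[xt ty].
  by rewrite (le_lt_trans ax)// (le_trans ty).
rewrite /muF stieltjes_itvoc// /F/= /Gc !clamp_id//.
  by rewrite ax (le_trans xy).
by rewrite yb (le_trans ax).
Unshelve. all: by end_near. Qed.

End density.

(** * The fundamental theorem for absolutely continuous functions *)
Section ac_derivative.
Variables (R : realType) (a b : R) (f : R -> R).
Hypotheses (ab : a < b) (ac : abs_continuous a b f).
Local Notation mu := (@lebesgue_measure R).

(** Apply the monotone case to the cumulated variation V of f and to V - f,
    which is nondecreasing because V increases at least as much as f. *)
Lemma abs_continuous_density : exists2 g : R -> R,
  mu.-integrable [set: R] (EFin \o g) &
  forall x y, a <= x -> x <= y -> y <= b ->
    (\int[mu]_(t in `]x, y]) (g t)%:E = (f y - f x)%:E)%E.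
Proof.
have ab' := ltW ab.
pose V := cumvar a f.
have Vge x y : x \in `[a, b] -> y \in `[a, b] -> x <= y ->
    `|f y - f x| <= V y - V x.
  by rewrite !in_itv/= => /andP[ax _] /andP[_ yb] xy; exact: (cumvar_ge ab' ac).
have [g1 ig1 g1E] : exists2 g : R -> R, mu.-integrable [set: R] (EFin \o g) &
    forall x y, a <= x -> x <= y -> y <= b ->
      (\int[mu]_(t in `]x, y]) (g t)%:E = (V y - V x)%:E)%E.
  apply: monotone_ac_density => //; last exact: (cumvar_ac ab' ac).
  by move=> x y xab yab xy; rewrite -subr_ge0 (le_trans _ (Vge x y xab yab xy)).
have [g2 ig2 g2E] : exists2 g : R -> R, mu.-integrable [set: R] (EFin \o g) &
    forall x y, a <= x -> x <= y -> y <= b ->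
      (\int[mu]_(t in `]x, y]) (g t)%:E = ((V y - f y) - (V x - f x))%:E)%E.
  apply: (monotone_ac_density ab (G := fun x => V x - f x)) => //.
    move=> x y xab yab xy; have := Vge x y xab yab xy.
    by have := ler_norm (f y - f x); lra.
  move=> e e0; have e20 : 0 < e / 2 by rewrite divr_gt0.
  have [d1 d10 acV] := cumvar_ac ab' ac e20.
  have [d2 d20 acf] := abs_continuous_lists ac e20.
  exists (Num.min d1 d2); first by rewrite lt_min d10.
  move=> l lab lp; rewrite lt_min => /andP[ld1 ld2].
  have := acV l lab lp ld1; have := acf l lab lp ld2; rewrite /increments -/V.
  set S1 := \sum_(_ <- _) _; set S2 := \sum_(_ <- _) _ => h1 h2.
  apply: (@le_trans _ _ (S2 + S1)); last by lra.
  rewrite /S1 /S2 -big_split/=; apply: ler_sum => p _.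
  by have := ler_norm (- (f p.2 - f p.1)); rewrite normrN; lra.
exists (fun t => g1 t - g2 t).
  rewrite (_ : EFin \o _ = (EFin \o g1) \- (EFin \o g2))%E//.
  by apply: integrableB; [|exact: ig1|exact: ig2].
move=> x y ax xy yb.
rewrite (_ : (fun t => _) = (fun t => (EFin \o g1) t - (EFin \o g2) t)%E)//.
rewrite integralB//; try exact: (integrableS measurableT).
rewrite [X in (X - _)%E](g1E _ _ ax xy yb) [X in (_ - X)%E](g2E _ _ ax xy yb).
by rewrite -EFinB; congr EFin; lra.
Qed.

(** Near an interior point f is a constant plus the indefinite integral of g, so
    Lebesgue differentiation applies. *)
Lemma abs_continuous_derive1_density (g : R -> R) :
  mu.-integrable [set: R] (EFin \o g) ->
  (forall x, a <= x -> x <= b -> (\int[mu]_(t in `]a, x]) (g t)%:E = (f x - f a)%:E)%E) ->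
  {ae mu, forall x, a < x < b -> derive1 f x = g x}.
Proof.
move=> ig gE.
have igS (A : set R) : measurable A -> mu.-integrable A (EFin \o g).
  by move=> mA; exact: (integrableS measurableT).
have := @FTC1 R g (BLeft a) (fun y => igS _ (measurable_itv _))
  (open_integrable_locally openT ig).
apply: filterS; first exact: (ae_filter_ringOfSetsType mu).
move=> x /= + /andP[ax xb]; rewrite lte_fin => /(_ ax)[].
set F := (X in derivable X) => dF F'.
rewrite -F' !derive1E.
rewrite (@near_eq_derive _ _ _ f (cst (f a) + F)).
  by rewrite deriveD// derive_cst add0r.
near=> t.
have at0 : a <= t by apply: ltW; near: t; exact: lt_nbhsr.
have tb : t <= b by apply: ltW; near: t; exact: lt_nbhsl.
rewrite /F fctE /cst /= /Rintegral -integral_itv_obnd_cbnd; last first.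
  by have /integrableP[] := igS _ (measurable_itv `]a, t]).
by rewrite gE//= addrC subrK.
Unshelve. all: by end_near. Qed.

(** Integrate the absolute value of the density, which is that of f' almost
    everywhere. *)
Lemma le_integral_derive1 x y : measurable_fun `[a, b] (derive1 f) ->
  a <= x -> x <= y -> y <= b ->
  (`|f y - f x|%:E <= \int[mu]_(t in `[x, y]) `|derive1 f t|%:E)%E.
Proof.
move=> mf ax xy yb; have [g ig gE] := abs_continuous_density.
have f'g : {ae mu, forall x, a < x < b -> derive1 f x = g x}.
  by apply: abs_continuous_derive1_density => // t at0 tb; exact: gE.
have mg : measurable_fun [set: R] g by apply/measurable_EFinP; case/integrableP: ig.
have mxy : measurable_fun `]x, y[ (derive1 f).
  apply: measurable_funS mf => // t /=; rewrite !in_itv/= => /andP[xt ty].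
  by rewrite !ltW ?(le_lt_trans ax) ?(lt_le_trans ty).
have mgxy : measurable_fun `]x, y[ (fun t => (g t)%:E).
  by apply/measurable_EFinP; exact: measurable_funTS.
have -> : (`|f y - f x|%:E = `|\int[mu]_(t in `]x, y[) (g t)%:E|)%E.
  by rewrite integral_itv_bndo_bndc// gE.
apply: le_trans (le_abse_integral _ _ _) _ => //.
rewrite (_ : (\int[mu]_(t in `]x, y[) `|(g t)%:E|
    = \int[mu]_(t in `]x, y[) `|derive1 f t|%:E)%E); last first.
  apply: ge0_ae_eq_integral => //.
  - exact: measurableT_comp.
  - by apply/measurable_EFinP; exact: measurableT_comp.
  - apply: filterS f'g; first exact: (ae_filter_ringOfSetsType mu).
    move=> t /= f'gt; rewrite in_itv/= => /andP[xt ty].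
    by rewrite f'gt// (le_lt_trans ax xt) (lt_le_trans ty yb).
apply: ge0_subset_integral => //.
- apply/measurable_EFinP; apply: measurableT_comp => //.
  apply: measurable_funS mf => // t /=; rewrite !in_itv/= => /andP[xt ty].
  by rewrite (le_trans ax) ?(le_trans ty).
- exact: subset_itv_oo_cc.
Qed.

End ac_derivative.

(** * Weighted inequalities of Hardy type *)
Section kernel_test.
Variable R : realType.
Local Notation mu := (@lebesgue_measure R).

(** The form of Hardy's inequality for L^1 norms: a bound of phi by the integrals
    of |G| along the sections of K is turned, by exchanging the integrals, into
    a bound by the integrals of w along the sections in the other direction. *)
Lemma kernel_test (D : set R) (K : set (R * R)) (phi w G U : R -> R) :
  measurable D -> measurable K ->
  measurable_fun D phi -> measurable_fun D w -> measurable_fun D G ->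
  measurable_fun D U ->
  (forall x, D x -> 0 <= w x) ->
  (forall x, D x -> (`|phi x|%:E
     <= \int[mu]_(t in D `&` [set t | K (x, t)]) `|G t|%:E)%E) ->
  (forall t, D t -> (\int[mu]_(x in D `&` [set x | K (x, t)]) (w x)%:E
     <= (U t)%:E)%E) ->
  (\int[mu]_(x in D) (`|phi x| * w x)%:E
     <= \int[mu]_(t in D) (`|G t| * U t)%:E)%E.
Proof.
move=> mD mK mphi mw mG mU w0 phiG wU.
have mKx x : measurable [set t | K (x, t)].
  rewrite (_ : mkset _ = xsection K x); first exact: measurable_xsection.
  by apply/seteqP; split => t /=; rewrite /xsection/= inE.
have mKt t : measurable [set x | K (x, t)].
  rewrite (_ : mkset _ = ysection K t); first exact: measurable_ysection.
  by apply/seteqP; split => x /=; rewrite /ysection/= inE.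
(* Extension by 0 outside D, to apply Tonelli's theorem on the whole plane. *)
pose w' : R -> R := w \_ D.
pose G' : R -> R := (fun t => `|G t|) \_ D.
have w'0 x : 0 <= w' x.
  by rewrite /w' patchE; case: ifPn => // /[!inE]; exact: w0.
have G'0 x : 0 <= G' x by rewrite /G' patchE; case: ifPn.
have mw' : measurable_fun [set: R] w' by have := (measurable_restrictT w mD).1 mw.
have mnG : measurable_fun D (fun t => `|G t|) by apply: measurableT_comp.
have mG' : measurable_fun [set: R] G'.
  by have := (measurable_restrictT _ mD).1 mnG.
pose H (z : R * R) : \bar R := (w' z.1 * (\1_K z * G' z.2))%:E.
have mH : measurable_fun [set: R * R] H.
  apply/measurable_EFinP; apply: measurable_funM.
    exact: (measurableT_comp mw' measurable_fst).
  apply: measurable_funM; first exact: measurable_indic.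
  exact: (measurableT_comp mG' measurable_snd).
have H0 z : (0 <= H z)%E by rewrite lee_fin !mulr_ge0.
have mDK x : measurable (D `&` [set t | K (x, t)]) by exact: measurableI.
have mDK' t : measurable (D `&` [set x | K (x, t)]) by exact: measurableI.
have mGE x : measurable_fun (D `&` [set t | K (x, t)]) (fun t => `|G t|%:E).
  by apply/measurable_EFinP; exact: (measurable_funS mD (@subIsetl _ _ _) mnG).
have mwE t : measurable_fun (D `&` [set x | K (x, t)]) (fun x => (w x)%:E).
  by apply/measurable_EFinP; exact: (measurable_funS mD (@subIsetl _ _ _) mw).
have KxE x t : (t \in [set t | K (x, t)]) = ((x, t) \in K).
  by apply/idP/idP; rewrite !inE.
have KtE x t : (x \in [set x | K (x, t)]) = ((x, t) \in K).
  by apply/idP/idP; rewrite !inE.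
have HxE x : (\int[mu]_t H (x, t) = (w' x)%:E *
    \int[mu]_(t in D `&` [set t | K (x, t)]) `|G t|%:E)%E.
  rewrite -ge0_integralZl_EFin//; [|exact: mDK|exact: mGE].
  rewrite [RHS]integral_mkcond; apply: eq_integral => t _.
  rewrite /H/= patchE in_setI KxE /G' patchE /indic.
  by case: (t \in D); case: (_ \in _); rewrite /= ?mul0r ?mulr0 ?mul1r.
have HtE t : (\int[mu]_x H (x, t) =
    (G' t)%:E * \int[mu]_(x in D `&` [set x | K (x, t)]) (w x)%:E)%E.
  rewrite -ge0_integralZl_EFin//; last 3 first.
  - exact: mDK'.
  - by move=> x [Dx _]; rewrite lee_fin w0.
  - exact: mwE.
  rewrite [RHS]integral_mkcond; apply: eq_integral => x _.
  rewrite /H/= patchE in_setI KtE /w' patchE /indic.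
  by case: (x \in D); case: (_ \in _); rewrite /= ?mul0r ?mulr0 ?mul1r// -EFinM mulrC.
apply: (@le_trans _ _ (\int[mu]_x \int[mu]_t H (x, t))%E).
  rewrite integral_mkcond; apply: ge0_le_integral => //.
  - move=> x _; rewrite patchE; case: ifPn => // /[!inE] Dx.
    by rewrite lee_fin mulr_ge0// w0.
  - have mpw : measurable_fun D (fun x => (`|phi x| * w x)%:E).
      apply/measurable_EFinP; apply: measurable_funM => //.
      exact: measurableT_comp.
    by have := (measurable_restrictT _ mD).1 mpw.
  - exact: measurable_fun_fubini_tonelli_F.
  - move=> x _; rewrite HxE patchE /w' patchE; case: ifPn => [|_]; last by rewrite mul0e.
    rewrite inE => Dx; rewrite EFinM muleC; apply: lee_wpmul2l; last exact: phiG.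
    by rewrite lee_fin w0.
rewrite (_ : (\int[mu]_x \int[mu]_t H (x, t) = \int[mu]_t \int[mu]_x H (x, t))%E);
  last by have := @fubini_tonelli _ _ _ _ R mu mu H mH H0.
rewrite [leRHS]integral_mkcond.
apply: ge0_le_integral => //.
- by move=> t _; apply: integral_ge0.
- exact: measurable_fun_fubini_tonelli_G.
- have mGU : measurable_fun D (fun x => (`|G x| * U x)%:E).
    by apply/measurable_EFinP; apply: measurable_funM.
  by have := (measurable_restrictT _ mD).1 mGU.
- move=> t _; rewrite HtE patchE /G' patchE; case: ifPn => [|_]; last by rewrite mul0e.
  by rewrite inE => Dt; rewrite EFinM; apply: lee_wpmul2l; [rewrite lee_fin|exact: wU].
Qed.

End kernel_test.

Lemma integral_le_primitive (R : realType) (F v w : R -> R) (p q : R) :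
  p <= q ->
  (forall x, p <= x <= q ->
    [/\ is_derive x 1 F (v x), {for x, continuous v} & 0 <= w x <= v x]) ->
  measurable_fun `[p, q] w ->
  (\int[@lebesgue_measure R]_(x in `[p, q]) (w x)%:E <= (F q - F p)%:E)%E.
Proof.
rewrite le_eqVlt => /predU1P[<- _ _|pq dF mw].
  by rewrite set_itv1 integral_set1 subrr.
have pqE x : `[p, q]%classic x -> p <= x <= q by rewrite /= in_itv.
have cv : {within `[p, q], continuous v}.
  by apply: continuous_in_subspaceT => x /[!inE] /pqE /dF[].
have cF (x : R) : p <= x <= q -> {for x, continuous F}.
  move=> /dF[[dFx _] _ _]; apply: differentiable_continuous.
  exact/derivable1_diffP.
rewrite EFinB -(@continuous_FTC2 _ v F p q)//.
- apply: ge0_le_integral => //.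
  + by move=> x /pqE/dF[_ _ /andP[]].
  + exact/measurable_EFinP.
  + by apply/measurable_EFinP; exact: subspace_continuous_measurable_fun.
  + by move=> x /pqE/dF[_ _ /andP[_]]; rewrite lee_fin.
- split.
  + move=> x; rewrite in_itv/= => /andP[px xq].
    have xpq : p <= x <= q by rewrite !ltW.
    by have [[]] := dF x xpq.
  + by apply: cvg_at_right_filter; apply: cF; rewrite lexx ltW.
  + by apply: cvg_at_left_filter; apply: cF; rewrite lexx ltW.
- move=> x; rewrite in_itv/= => /andP[px xq]; rewrite derive1E.
  have xpq : p <= x <= q by rewrite !ltW.
  by have [[_ ->]] := dF x xpq.
Qed.

Lemma abs_continuous_continuous (R : realType) (a b : R) (f : R -> R) :
  abs_continuous a b f -> {in `]a, b[, continuous f}.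
Proof.
move=> ac x; rewrite in_itv/= => /andP[ax xb].
apply/cvgrPdist_lt => e e0; have [d d0 acd] := abs_continuous_lists ac e0.
near=> y.
have ay : a <= y by apply: ltW; near: y; exact: lt_nbhsr.
have yb : y <= b by apply: ltW; near: y; exact: lt_nbhsl.
have xyd : `|x - y| < d by near: y; apply: cvgr_dist_lt.
have inc p q : a <= p -> p <= q -> q <= b -> q - p < d -> `|f q - f p| < e.
  move=> ap pq qb qpd; have := acd [:: (p, q)].
  rewrite /within_itv /proper_itvs /total_length /increments/= !big_seq1/=.
  by rewrite ap qb pq => /(_ isT isT qpd).
have [xy|/ltW yx] := leP x y.
  rewrite distrC; apply: inc => //; first exact: ltW.
  by rewrite -(ger0_norm (_ : 0 <= y - x)) ?subr_ge0// distrC.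
apply: inc => //; first exact: ltW.
by rewrite -(ger0_norm (_ : 0 <= x - y)) ?subr_ge0.
Unshelve. all: by end_near. Qed.

(** Used for quotients by powers of delta, which vanishes at the end points: on
    the open interval these powers are continuous, hence measurable. *)
Lemma integral_cc_oo (R : realType) (a b : R) (F : R -> \bar R) :
  measurable_fun `]a, b[ F ->
  (\int[@lebesgue_measure R]_(x in `[a, b]) F x =
   \int[@lebesgue_measure R]_(x in `]a, b[) F x)%E.
Proof.
move=> mF; rewrite -integral_itv_obnd_cbnd ?integral_itv_bndo_bndc//.
exact/emeasurable_fun_itv_bndo_bndcP.
Qed.

Section hardy.
Variables (R : realType) (a b nu m c al be : R) (f : R -> R).
Hypotheses (ab : a < b) (A0 : 0 <= 1 - nu ^+ 2 * m ^+ 2).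
Hypotheses (ac : abs_continuous a b f) (fa : f a = 0) (fb : f b = 0).
Local Notation mu := (@lebesgue_measure R).
Local Notation d := (delta a b).
Local Notation h := (delta0 a b).
Local Notation O := (`]a, b[%classic : set R).
Hypothesis int : mu.-integrable `[a, b] (fun x => (derive1 f x / d x)%:E).
Let U s := al / s + be.
Hypothesis maj : weight_majorant nu m h c U.
Let hw := hweight nu m h c.
Let mid := (a + b) / 2.

Let midE : mid = a + h /\ mid = b - h.
Proof. by rewrite /mid /delta0; split; lra. Qed.

Let h0 : 0 < h. Proof. by rewrite divr_gt0 ?subr_gt0. Qed.

Let dl x : x <= mid -> d x = x - a.
Proof. by rewrite /mid /delta => xm; apply/min_idPr; lra. Qed.

Let dr x : mid <= x -> d x = b - x.
Proof. by rewrite /mid /delta => xm; apply/min_idPl; lra. Qed.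

Let d_itv x : a < x < b -> 0 < d x <= h.
Proof.
move=> /andP[ax xb]; rewrite /delta lt_min !subr_gt0 xb ax/= /delta0 ge_min.
by apply/orP; have [xm|xm] := leP x mid; [right|left]; rewrite /mid in xm; lra.
Qed.

Let d_cont : continuous d.
Proof.
move=> x.
have c1 : {for x, continuous (fun x : R => b - x)}.
  by apply: cvgB; [exact: cvg_cst|exact: cvg_id].
have c2 : {for x, continuous (fun x : R => x - a)}.
  by apply: cvgB; [exact: cvg_id|exact: cvg_cst].
exact: (continuous_min c1 c2).
Qed.

Let measurable_O (F : R -> R) : (forall s, 0 < s <= h -> {for s, continuous F}) ->
  measurable_fun O (F \o d).
Proof.
move=> cF; apply: open_continuous_measurable_fun; first exact: interval_open.
move=> x; rewrite inE/= in_itv/= => xO.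
by apply: continuous_comp; [exact: d_cont|apply: cF; exact: d_itv].
Qed.

Let hw0 s : 0 < s -> 0 <= hw s.
Proof.
move=> s0; rewrite addr_ge0// divr_ge0 ?divr_ge0 ?sqr_ge0 ?powR_ge0//.
Qed.

Let mhw : measurable_fun O (hw \o d).
Proof. by apply: measurable_O => s /andP[s0 _]; exact: hweight_continuous. Qed.

Let mf : measurable_fun O f.
Proof.
apply: open_continuous_measurable_fun; first exact: interval_open.
by move=> x /[!inE]; exact: abs_continuous_continuous.
Qed.

Let cV s : 0 < s -> {for s, continuous (fun x : R => x^-1)}.
Proof. by move=> s0; apply: inv_continuous; rewrite gt_eqF. Qed.

Let mdf : measurable_fun O (derive1 f).
Proof.
have mq : measurable_fun O (fun x => derive1 f x / d x).
  have /integrableP[/measurable_EFinP m1 _] := int.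
  by apply: measurable_funS m1 => //; exact: subset_itv_oo_cc.
have md : measurable_fun O d by apply: (measurable_O (F := id)) => s _; exact: cvg_id.
apply: eq_measurable_fun (measurable_funM mq md) => x /[!inE]/=.
by rewrite in_itv/= => /d_itv/andP[dx _]; rewrite divfK// gt_eqF.
Qed.

Let mdfcc : measurable_fun `[a, b] (derive1 f).
Proof. exact: measurable_fun_itv_cc mdf. Qed.

Let subO (D : set R) : D `<=` O -> forall g : R -> R,
  measurable_fun O g -> measurable_fun D g.
Proof. by move=> DO g mg; apply: (measurable_funS _ DO mg). Qed.

Let mU : measurable_fun O (U \o d).
Proof.
apply: measurable_O => s /andP[s0 _]; apply: continuousD; last exact: cst_continuous.
by apply: continuousM; [exact: cst_continuous|exact: cV].
Qed.

(* Here f x is recovered from a, that is from the points t <= x. *)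
Let left_half :
  (\int[mu]_(x in `]a, mid]) (`|f x| * (hw \o d) x)%:E
   <= \int[mu]_(x in `]a, mid]) (`|derive1 f x| * (U \o d) x)%:E)%E.
Proof.
have [ma mb] := midE.
have DO : `]a, mid]%classic `<=` O.
  by move=> x /=; rewrite !in_itv/= => /andP[-> xm]/=; move: h0; lra.
apply: (@kernel_test _ _ [set z | z.2 <= z.1]) => //; try exact: subO.
- rewrite -[X in measurable X]setTI.
  exact: (measurable_fun_le measurableT measurable_snd measurable_fst).
- by move=> x /DO/=; rewrite in_itv/= => /d_itv/andP[? _]; exact: hw0.
- move=> x Dx; move: (Dx); rewrite /= in_itv/= => /andP[ax xm].
  rewrite (_ : _ `&` _ = `]a, x]%classic); last first.
    apply/seteqP; split => t /=; rewrite !in_itv/=.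
      by move=> [/andP[-> _]].
    by move=> /andP[-> tx]; rewrite (le_trans tx).
  have := @le_integral_derive1 _ _ _ _ ab ac a x mdfcc (lexx _) (ltW ax).
  rewrite fa subr0 => /(_ _)/le_trans; apply; first by move: h0; lra.
  rewrite integral_itv_obnd_cbnd//.
  apply/measurable_EFinP; apply: measurableT_comp => //.
  apply: measurable_funS mdf => // t /=; rewrite !in_itv/= => /andP[-> tx]/=.
  by move: h0; lra.
- move=> t; rewrite /= in_itv/= => /andP[at0 tm].
  rewrite (_ : _ `&` _ = `[t, mid]%classic); last first.
    apply/seteqP; split => x /=; rewrite !in_itv/=.
      by move=> [/andP[_ ->] ->].
    by move=> /andP[tx ->]; rewrite (lt_le_trans at0).
  have [V [v VvP]] := maj.
  have Vt : V (t - a) - V h <= U (d t).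
    by rewrite dl//; have [] := VvP (t - a); rewrite // subr_gt0 at0 lerBlDl -ma.
  apply: (@le_trans _ _ (V (t - a) - V h)%:E); last by rewrite lee_fin.
  have := @integral_le_primitive _ (fun x => - V (x - a)) (fun x => v (x - a))
    (hw \o d) t mid tm.
  rewrite opprK [- _ + _]addrC (_ : mid - a = h); last by rewrite ma; lra.
  apply.
    move=> x /andP[tx xm]; have sx : 0 < x - a <= h by move: at0 xm; lra.
    have [dV cv wv _] := VvP _ sx; split.
    - have dS : is_derive x 1 (fun x => x - a) 1.
        by apply: is_derive_eq; rewrite subr0.
      have dVS : is_derive x 1 (V \o (fun x => x - a)) (- v (x - a) * 1).
        exact: is_derive1_comp.
      have dN : is_derive x 1 (- (V \o (fun x => x - a))) (- (- v (x - a) * 1)).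
        exact: is_deriveN.
      by move: dN; rewrite mulr1 opprK.
    - apply: continuous_comp => //; apply: cvgB; [exact: cvg_id|exact: cvg_cst].
    - by rewrite /= dl// hw0//=; case/andP: sx.
  apply: subO mhw => x /=; rewrite !in_itv/= => /andP[tx xm].
  by move: h0; lra.
Qed.

(* Here f x is recovered from b, that is from the points t >= x. *)
Let right_half :
  (\int[mu]_(x in `]mid, b[) (`|f x| * (hw \o d) x)%:E
   <= \int[mu]_(x in `]mid, b[) (`|derive1 f x| * (U \o d) x)%:E)%E.
Proof.
have [ma mb] := midE.
have DO : `]mid, b[%classic `<=` O.
  by move=> x /=; rewrite !in_itv/= => /andP[xm ->]; rewrite andbT; move: h0; lra.
apply: (@kernel_test _ _ [set z | z.1 <= z.2]) => //; try exact: subO.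
- rewrite -[X in measurable X]setTI.
  exact: (measurable_fun_le measurableT measurable_fst measurable_snd).
- by move=> x /DO/=; rewrite in_itv/= => /d_itv/andP[? _]; exact: hw0.
- move=> x Dx; move: (Dx); rewrite /= in_itv/= => /andP[mx xb].
  rewrite (_ : _ `&` _ = `[x, b[%classic); last first.
    apply/seteqP; split => t /=; rewrite !in_itv/=.
      by move=> [/andP[_ ->] ->].
    by move=> /andP[xt ->]; rewrite (lt_le_trans mx).
  have ax : a <= x by move: h0; lra.
  have := @le_integral_derive1 _ _ _ _ ab ac x b mdfcc ax (ltW xb) (lexx _).
  rewrite fb sub0r normrN => /le_trans; apply.
  rewrite integral_itv_bndo_bndc//.
  apply/measurable_EFinP; apply: measurableT_comp => //.
  apply: measurable_funS mdf => // t /=; rewrite !in_itv/= => /andP[xt ->].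
  by rewrite andbT; move: h0; lra.
- move=> t; rewrite /= in_itv/= => /andP[mt tb].
  rewrite (_ : _ `&` _ = `]mid, t]%classic); last first.
    apply/seteqP; split => x /=; rewrite !in_itv/=.
      by move=> [/andP[-> _]].
    by move=> /andP[-> xt]; rewrite (le_lt_trans xt).
  have mtO : measurable_fun `[mid, t] (hw \o d).
    apply: subO mhw => x /=; rewrite !in_itv/= => /andP[mx xt].
    by move: h0; lra.
  rewrite integral_itv_obnd_cbnd; last first.
    apply/measurable_EFinP; apply: (measurable_funS _ _ mtO) => //.
    exact: subset_itv_oc_cc.
  have [V [v VvP]] := maj.
  have Vt : V (b - t) - V h <= U (d t).
    have sx : 0 < b - t <= h by rewrite subr_gt0 tb/=; move: mt; rewrite mb; lra.
    by rewrite (dr (ltW mt)); have [] := VvP _ sx.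
  apply: (@le_trans _ _ (V (b - t) - V h)%:E); last by rewrite lee_fin.
  have := @integral_le_primitive _ (fun x => V (b - x)) (fun x => v (b - x))
    (hw \o d) mid t (ltW mt).
  rewrite (_ : b - mid = h); last by rewrite mb; lra.
  apply => // x /andP[mx xt]; have sx : 0 < b - x <= h by move: tb mx; lra.
  have [dV cv wv _] := VvP _ sx; split.
  - have dS : is_derive x 1 (fun x => b - x) (- 1).
      by apply: is_derive_eq; rewrite add0r mul1r.
    have dVS : is_derive x 1 (V \o (fun x => b - x)) (- v (b - x) * - 1).
      exact: is_derive1_comp.
    by move: dVS; rewrite mulrN1 opprK.
  - by apply: continuous_comp => //; apply: cvgB; [exact: cvg_cst|exact: cvg_id].
  - by rewrite /= dr// hw0//=; case/andP: sx.
Qed.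

(* U dominates the integral over [s, h] of a nonnegative weight. *)
Let U0 s : 0 < s <= h -> 0 <= U s.
Proof.
move=> /andP[s0 sh]; have [V [v VvP]] := maj.
have sx : 0 < s <= h by rewrite s0.
rewrite -lee_fin; apply: (@le_trans _ _ (- V h - - V s)%:E); last first.
  by rewrite lee_fin opprK addrC; have [] := VvP _ sx.
have mhs : measurable_fun `[s, h] hw.
  apply: subspace_continuous_measurable_fun => //.
  apply: continuous_in_subspaceT => x /[!inE]/=; rewrite in_itv/= => /andP[sx' _].
  by apply: hweight_continuous; exact: lt_le_trans sx'.
apply: le_trans (integral_le_primitive (F := - V) (v := v) sh _ mhs).
  apply: integral_ge0 => x /=; rewrite in_itv/= => /andP[sx' _].
  by rewrite lee_fin hw0// (lt_le_trans s0).
move=> x /andP[sx' xh]; have x0 : 0 < x <= h by rewrite xh (lt_le_trans s0).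
have [dV cv wv _] := VvP _ x0; split => //.
  by rewrite -[v x]opprK; exact: is_deriveN.
by rewrite wv hw0//; case/andP: x0.
Qed.

Let whole :
  (\int[mu]_(x in O) (`|f x| * (hw \o d) x)%:E
   <= \int[mu]_(x in O) (`|derive1 f x| * (U \o d) x)%:E)%E.
Proof.
have [ma mb] := midE.
have OE : O = `]a, mid]%classic `|` `]mid, b[%classic.
  apply/seteqP; split => x /=; rewrite !in_itv/=.
    by move=> /andP[-> ->]; rewrite andbT; have [|] := leP x mid; [left|right].
  by move=> [] /andP[x1 x2]; apply/andP; split => //; move: h0; lra.
have Odisj : [disjoint `]a, mid]%classic & `]mid, b[%classic].
  apply/disj_setPS => x [] /=; rewrite !in_itv/= => /andP[_ xm] /andP[mx _].
  by move: (lt_le_trans mx xm); rewrite ltxx.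
have mlhs : measurable_fun O (fun x => (`|f x| * (hw \o d) x)%:E).
  by apply/measurable_EFinP; apply: measurable_funM => //; exact: measurableT_comp.
have mrhs : measurable_fun O (fun x => (`|derive1 f x| * (U \o d) x)%:E).
  by apply/measurable_EFinP; apply: measurable_funM => //; exact: measurableT_comp.
rewrite OE !ge0_integral_setU// -?OE//.
- by apply: leeD; [exact: left_half|exact: right_half].
- by move=> x /=; rewrite in_itv/= => /d_itv dx; rewrite lee_fin mulr_ge0// U0.
- by move=> x /=; rewrite in_itv/= => /d_itv/andP[dx _]; rewrite lee_fin mulr_ge0// hw0.
Qed.

Let integrable_df_d : mu.-integrable O (fun x => (`|derive1 f x| / d x)%:E).
Proof.
have i1 : mu.-integrable O (fun x => (derive1 f x / d x)%:E).
  by apply: (integrableS _ _ _ int) => //; exact: subset_itv_oo_cc.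
apply: eq_integrable (integrable_abse i1) => // x /[!inE]/=.
by rewrite in_itv/= => /d_itv/andP[dx _]; rewrite normrM normfV (gtr0_norm dx).
Qed.

Let integrable_df : mu.-integrable O (fun x => `|derive1 f x|%:E).
Proof.
apply: (le_integrable _ _ _ (integrableZl _ h integrable_df_d)) => //.
  by apply/measurable_EFinP; exact: measurableT_comp.
move=> x /=; rewrite in_itv/= => /d_itv/andP[dx dh].
rewrite lee_fin normr_id normrM (gtr0_norm h0) normrM normr_id.
by rewrite normfV (gtr0_norm dx) mulrCA ler_peMr// ler_pdivlMr// mul1r.
Qed.

(** A pointwise majorant of the integrals of the weight gives the integral
    inequality; both cases of the theorem are instances, with different al
    and be. *)
Lemma hardy_majorant :
  (((1 - nu ^+ 2 * m ^+ 2) / 4)%:E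
     * \int[mu]_(x in `[a, b]) (`|f x| / d x ^+ 2)%:E
   + (c ^+ 2 / h `^ m)%:E * \int[mu]_(x in `[a, b]) (`|f x| / d x `^ (2 - m))%:E
   <= al%:E * \int[mu]_(x in `[a, b]) (`|derive1 f x| / d x)%:E
      + be%:E * \int[mu]_(x in `[a, b]) `|derive1 f x|%:E)%E.
Proof.
have mnf : measurable_fun O (fun x => `|f x|) by exact: measurableT_comp.
have m2 : measurable_fun O (fun x => (`|f x| / d x ^+ 2)%:E).
  apply/measurable_EFinP; apply: measurable_funM => //.
  apply: (measurable_O (F := fun s => (s ^+ 2)^-1)) => s /andP[s0 _].
  by apply: continuousV; [rewrite gt_eqF ?exprn_gt0|exact: exprn_continuous].
have mm : measurable_fun O (fun x => (`|f x| / d x `^ (2 - m))%:E).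
  apply/measurable_EFinP; apply: measurable_funM => //.
  apply: (measurable_O (F := fun s => (s `^ (2 - m))^-1)) => s /andP[s0 _].
  by apply: continuousV; [rewrite gt_eqF ?powR_gt0|exact: continuous_powR].
have d0 x : O x -> 0 < d x by rewrite /= in_itv/= => /d_itv/andP[].
rewrite !integral_cc_oo//; last 2 first.
- by case/integrableP: integrable_df.
- by case/integrableP: integrable_df_d.
have -> : (al%:E * \int[mu]_(x in O) (`|derive1 f x| / d x)%:E
    + be%:E * \int[mu]_(x in O) `|derive1 f x|%:E
    = \int[mu]_(x in O) (`|derive1 f x| * (U \o d) x)%:E)%E.
  rewrite -!integralZl// -integralD//; try exact: integrableZl.
  apply: eq_integral => x _; rewrite -!EFinM -EFinD; congr EFin.
  by rewrite /U/=; ring.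
apply: le_trans whole; rewrite le_eqVlt; apply/orP; left; apply/eqP.
have A4 : 0 <= (1 - nu ^+ 2 * m ^+ 2) / 4 by rewrite divr_ge0.
have ch : 0 <= c ^+ 2 / h `^ m by rewrite divr_ge0 ?powR_ge0 ?sqr_ge0.
have f2 x : O x -> (0 <= (`|f x| / d x ^+ 2)%:E)%E.
  by rewrite lee_fin divr_ge0 ?sqr_ge0.
have fm x : O x -> (0 <= (`|f x| / d x `^ (2 - m))%:E)%E.
  by rewrite lee_fin divr_ge0 ?powR_ge0.
rewrite -!ge0_integralZl_EFin//.
rewrite -ge0_integralD//.
- apply: eq_integral => x _; rewrite -!EFinM -EFinD; congr EFin.
  by rewrite /hw /hweight/=; ring.
- by move=> x _; rewrite -EFinM lee_fin mulr_ge0 ?divr_ge0 ?sqr_ge0.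
- exact: measurable_funeM.
- by move=> x _; rewrite -EFinM lee_fin mulr_ge0 ?divr_ge0 ?sqr_ge0 ?powR_ge0.
- exact: measurable_funeM.
Qed.

End hardy.

(** * The two inequalities *)
Unset Implicit Arguments.
Set Strict Implicit.
Set Printing Implicit Defensive.

Theorem theorem1 (R : realType) (a b m nu : R) (f : R -> R) :
  a < b -> 0 < m -> 0 < nu -> nu <= 1 / m ->
  abs_continuous a b f -> f a = 0 -> f b = 0 ->
  (@lebesgue_measure R).-integrable `[a, b] (fun x => (derive1 f x / delta a b x)%:E) ->
  (forall lambda c : R,
     0 <= lambda -> lambda < (1 + nu * m) / 2 ->
     is_first_bessel_root nu m lambda c ->
     (((1 - nu ^+ 2 * m ^+ 2) / 4)%:E
        * \int[@lebesgue_measure R]_(x in `[a, b]) (`|f x| / delta a b x ^+ 2)%:E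
      + (c ^+ 2 / delta0 a b `^ m)%:E
        * \int[@lebesgue_measure R]_(x in `[a, b]) (`|f x| / delta a b x `^ (2 - m))%:E
      <= ((1 + nu * m) / 2 - lambda ^+ 2)%:E
           * \int[@lebesgue_measure R]_(x in `[a, b]) (`|derive1 f x| / delta a b x)%:E
         + ((lambda ^+ 2 - lambda) / delta0 a b)%:E
           * \int[@lebesgue_measure R]_(x in `[a, b]) `|derive1 f x|%:E)%E) /\
  (forall lambda c : R,
     lambda <= 0 ->
     is_first_bessel_root nu m lambda c ->
     (((1 - nu ^+ 2 * m ^+ 2) / 4)%:E
        * \int[@lebesgue_measure R]_(x in `[a, b]) (`|f x| / delta a b x ^+ 2)%:E
      + (c ^+ 2 / delta0 a b `^ m)%:E
        * \int[@lebesgue_measure R]_(x in `[a, b]) (`|f x| / delta a b x `^ (2 - m))%:E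
      <= ((1 + nu * m) / 2)%:E
           * \int[@lebesgue_measure R]_(x in `[a, b]) (`|derive1 f x| / delta a b x)%:E
         - (lambda / delta0 a b)%:E
           * \int[@lebesgue_measure R]_(x in `[a, b]) `|derive1 f x|%:E)%E).
Proof.
move=> ab m0 nu0 num ac fa fb int.
have A0 : 0 <= 1 - nu ^+ 2 * m ^+ 2.
  have nm0 : 0 <= nu * m by rewrite mulr_ge0// ltW.
  by rewrite subr_ge0 -exprMn expr_le1// -ler_pdivlMr.
have h0 : 0 < delta0 a b by rewrite divr_gt0 ?subr_gt0.
split=> lambda c lam0.
  move=> _ [root _].
  have phi0 := reduced_bessel_neq0 nu0 m0 root.
  have lE := bessel_root_logder nu0 m0 root.
  apply: hardy_majorant => //.
  exact: (weight_majorant_ge0 nu0 m0 h0 phi0 lE lam0).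
move=> [root _].
have phi0 := reduced_bessel_neq0 nu0 m0 root.
have lE := bessel_root_logder nu0 m0 root.
(* Bring the subtracted term into the form be * integral. *)
rewrite -mulNe -EFinN.
apply: hardy_majorant => //.
exact: (weight_majorant_le0 nu0 m0 h0 phi0 lE).
Qed.
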